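(* Let $d\ge1$ and let $\mathbf{x}\in\mathbb{R}^d$ be a standard Laplace random vector, and set $S=\sum_{j=1}^d|x_j|$. For every function $f:\partial B_1^d\to\mathbb{R}$ that is $1$-Lipschitz (with respect to the Euclidean norm) and all $r>0$, \[ \mathbb{P}\big(|f(\mathbf{x}/S)-\mathbb{E}f(\mathbf{x}/S)|>r\big)\le 361\exp\{-0.003\,rd\}. \]
   Context: A real random variable is standard Laplace if it has density $e^{-|x|}/2$; a random vector in $\mathbb{R}^d$ is a standard Laplace vector if its coordinates are independent standard Laplace random variables. $\partial B_1^d=\{\mathbf{x}\in\mathbb{R}^d:\sum_{i}|x_i|=1\}$. *)

(* Defs.v *)
From HB Require Import structures.
From mathcomp Require Import all_boot all_order all_algebra.
From mathcomp Require Import all_classical all_reals all_analysis.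
Set Implicit Arguments. Unset Strict Implicit. Unset Printing Implicit Defensive.
Import Order.TTheory GRing.Theory Num.Theory.
Local Open Scope classical_set_scope.
Local Open Scope ring_scope.

Definition euclid_norm (R : realType) (d : nat) (v : 'rV[R]_d) : R :=
  Num.sqrt (\sum_(i < d) (v ord0 i) ^+ 2).

Definition l1_norm (R : realType) (d : nat) (v : 'rV[R]_d) : R :=
  \sum_(i < d) `|v ord0 i|.

Definition l1_sphere (R : realType) (d : nat) : set 'rV[R]_d :=
  [set v | l1_norm v = 1].
Arguments l1_sphere : clear implicits.

(* f is 1-Lipschitz on the l1 sphere w.r.t. the Euclidean norm
   (values of f outside the sphere are irrelevant) *)
Definition lipschitz1_on_l1_sphere (R : realType) (d : nat) (f : 'rV[R]_d -> R) :=
  forall u v, u \in l1_sphere R d -> v \in l1_sphere R d ->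
    `|f u - f v| <= euclid_norm (u - v).

Definition std_laplace_rv (dT : measure_display) (T : measurableType dT)
  (R : realType) (P : probability T R) (X : T -> R) :=
  measurable_fun setT X /\
  forall A : set R, measurable A ->
    P (X @^-1` A) = (\int[lebesgue_measure]_(x in A) ((expR (- `|x|)) / 2)%:E)%E.

(* mutual independence of a finite family of real random variables:
   product rule for every choice of Borel sets (taking B i = setT recovers
   every subfamily) *)
Definition mutually_independent (dT : measure_display) (T : measurableType dT)
  (R : realType) (P : probability T R) (n : nat) (X : 'I_n -> T -> R) :=
  forall B : 'I_n -> set R, (forall i, measurable (B i)) ->
    P (\bigcap_(i in [set: 'I_n]) (X i @^-1` B i)) =
    (\prod_(i < n) P (X i @^-1` B i))%E.

Definition std_laplace_vector (dT : measure_display) (T : measurableType dT)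
  (R : realType) (P : probability T R) (d : nat) (X : 'I_d -> T -> R) :=
  (forall i, std_laplace_rv P (X i)) /\ mutually_independent P X.

(* Main.v *)
Require Import Defs.
From HB Require Import structures.
From mathcomp Require Import all_boot all_order all_algebra.
From mathcomp Require Import all_classical all_reals all_analysis.
From mathcomp Require Import measurable_realfun ring lra zify.
Set Implicit Arguments. Unset Strict Implicit. Unset Printing Implicit Defensive.
Import Order.TTheory GRing.Theory Num.Theory.
Import numFieldNormedType.Exports.
Local Open Scope classical_set_scope.
Local Open Scope ring_scope.

(* The core is a Maurey-type inequality for the Laplace law [m]: if
   [A x * B y <= cosh ((x - y) / 4) ^ 2] for all [x], [y], then
   [(\int A dm) * (\int B dm) <= 1].  A change of variable turns [m] into the
   triangular law on ]-1, 1[, for which this is an instance of the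
   Prekopa-Leindler inequality.  The inequality tensorizes by integrating one
   coordinate at a time, and since [cosh (u / 4) ^ 2 >= exp (a |u| - 8 a ^ 2)]
   for [0 <= a <= 1 / 2], it bounds [E exp (F - E F)] by [exp (8 a ^ 2)] when [F]
   is [a]-Lipschitz for the Euclidean norm, and by [exp (8 d a ^ 2)] when it is
   [a]-Lipschitz for the l1 norm.

   To apply it to [f (x / S)], extend [f] to a 1-Lipschitz function [F] on R^d and
   let [M = E S], so that [F (x / M)] is [1 / M]-Lipschitz with [M >= 9 d / 10].
   Then [|F (x / S) - F (x / M)| <= (|x|_2 ^ 2 + 2 (S - M) ^ 2) / M ^ 2], and the
   tails of [|x|_2] and [|S - M|] at the scale [d sqrt r] are [exp (- c r d)].
   The bound is trivial unless [r d >= 1600], and then the bias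
   [|E F (x / S) - E F (x / M)| <= 90 / d] is below [r / 10]. *)

(** The map [x -> x / S] is not Lipschitz near the origin, so concentration of Lipschitz functions
    of [x] does not apply to it directly. Dividing by the constant [M] is harmless, and the exchange
    is affordable because its error is quadratic in [|x|_2] and [S - M]: an error of order [r] needs
    deviations of order [d sqrt r], where the Gaussian tail [exp (- b ^ 2 / (32 d))] of [S] already
    has an exponent proportional to [r d]. The values of [f] on the sphere differ by at most 2, so
    only [r <= 2] matters, and then [d sqrt r] dominates a multiple of [r d] in the exponential tail
    of [|x|_2].

    The deviation [r] is shared as 8/10 for the exchange, 1/10 for the fluctuation of [F (x / M)]
    and 1/10 for the bias. The exponents obtained are [r d / 200] from [S], [r d / 6] from [|x|_2]
    and [9 r d / 200] from [F (x / M)], with prefactors of sum 29. All moments are drawn from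
    [E exp (a |X_i|) = 1 / (1 - a)] by elementary inequalities for the exponential, so 9/10 and 8/3
    are bounds and not exact means. *)

(** * Integration against a measure given by a density *)

Definition density_measure (dT : measure_display) (T : measurableType dT)
    (R : realType) (mu : {measure set T -> \bar R}) (g : T -> R) (V : set T) :=
  (\int[mu]_(x in V) (g x)%:E)%E.

Section density_measure.
Local Open Scope ereal_scope.
Context (dT : measure_display) (T : measurableType dT) (R : realType).
Variables (mu : {measure set T -> \bar R}) (g : T -> R).
Hypotheses (mg : measurable_fun setT g) (g0 : forall x, (0 <= g x)%R).

Let meg : measurable_fun setT (EFin \o g). Proof. exact/measurable_EFinP. Qed.

Local Notation nu := (density_measure mu g).

Let nu0 : nu set0 = 0. Proof. by rewrite /density_measure integral_set0. Qed.

Let nu_ge0 A : 0 <= nu A. Proof. by apply: integral_ge0 => x _; rewrite lee_fin. Qed.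

Let nu_sigma_additive : semi_sigma_additive nu.
Proof.
move=> /= F mF tF mUF; rewrite /density_measure; apply: cvg_toP.
  apply: ereal_nondecreasing_is_cvgn => m n mn.
  by apply: lee_sum_nneg_natr => // k _ _; exact: nu_ge0.
rewrite ge0_integral_bigcup//=; first exact: measurable_funTS.
by move=> x _; rewrite lee_fin.
Qed.

Let nuM := isMeasure.Build _ _ _ nu nu0 nu_ge0 nu_sigma_additive.
HB.instance Definition _ := nuM.
Let nuP : {measure set T -> \bar R} := HB.pack nu nuM.

Import HBNNSimple.

Let integral_nnsfun (f : {nnsfun T >-> R}) :
  \int[nuP]_x (f x)%:E = \int[mu]_x ((f x)%:E * (g x)%:E).
Proof.
under [LHS]eq_integral do rewrite fimfunE -fsumEFin//.
rewrite [LHS]ge0_integral_fsum//; last 2 first.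
  - by move=> r; exact/measurable_EFinP/measurableT_comp.
  - by move=> n x _; rewrite EFinM nnfun_muleindic_ge0.
under [RHS]eq_integral.
  move=> x xD; rewrite muleC fimfunE -fsumEFin// ge0_mule_fsumr; last first.
    by move=> r; rewrite EFinM nnfun_muleindic_ge0.
  over.
rewrite [RHS]ge0_integral_fsum//; last 2 first.
  - move=> r; apply: emeasurable_funM => //.
    by apply/measurable_EFinP; apply/measurableT_comp.
  - move=> n x _; apply: mule_ge0; first by rewrite lee_fin.
    by rewrite EFinM nnfun_muleindic_ge0.
apply: eq_fsbigr => r _.
have [r0|r0] := ltP r 0%R.
  have Z x : (r * \1_(f @^-1` [set r]) x)%:E = 0 :> \bar R.
    rewrite indicE; case: (x \in _) / asboolP => [H|]; last by rewrite mulr0.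
    by move: r0; rewrite -(H : f x = r) ltNge fun_ge0.
  by rewrite !integral0_eq// => x _; rewrite Z ?mule0.
under eq_integral do rewrite EFinM.
rewrite ge0_integralZl//; last first.
  by apply/measurable_EFinP.
rewrite integral_indic// setIT.
under eq_integral do rewrite EFinM muleCA.
rewrite ge0_integralZl//; last 2 first.
- by apply: emeasurable_funM => //; apply/measurable_EFinP.
- by move=> x _; rewrite mule_ge0// lee_fin.
congr (_ * _).
rewrite /= /density_measure [LHS]integral_mkcond; apply: eq_integral => x _.
rewrite patchE indicE; case: ifP => _; first by rewrite mule1.
by rewrite mule0.
Qed.

(** Simple functions and monotone convergence. The measure [m] is only required to agree with the
    density on measurable sets, which is what [std_laplace_rv] says of the law of a coordinate. *)
Lemma ge0_integral_density (m : {measure set T -> \bar R}) (f : T -> \bar R) :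
  (forall A, measurable A -> m A = nu A) ->
  measurable_fun setT f -> (forall x, 0 <= f x) ->
  \int[m]_x f x = \int[mu]_x (f x * (g x)%:E).
Proof.
move=> mE mf f0.
rewrite (@eq_measure_integral _ _ _ setT nuP)//; last by move=> A mA _; rewrite mE.
pose f_ := nnsfun_approx measurableT mf.
transitivity (lim (\int[nuP]_x (f_ n x)%:E @[n --> \oo])).
  rewrite -monotone_convergence//=.
  - apply: eq_integral => ? /[!inE] xD; apply/esym/cvg_lim => //=.
    exact: cvg_nnsfun_approx.
  - by move=> n; exact/measurable_EFinP/measurable_funTS.
  - by move=> n ? _; rewrite lee_fin.
  - by move=> ? _ ? ? mn; rewrite lee_fin; exact/lefP/nd_nnsfun_approx.
under eq_fun do rewrite integral_nnsfun.
rewrite -monotone_convergence//=.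
- apply: eq_integral => x _; apply: cvg_lim => //.
  by apply: cvgeZr => //; exact: cvg_nnsfun_approx.
- by move=> n; apply: emeasurable_funM => //; apply/measurable_EFinP.
- by move=> n x _; rewrite mule_ge0// lee_fin.
- move=> x _ m' n mn; apply: lee_wpmul2r; first by rewrite lee_fin.
  by rewrite lee_fin; exact/lefP/nd_nnsfun_approx.
Qed.

End density_measure.

(** * Two-sided exponential measures and the map onto ]-1, 1[ *)

(** Each half-line has mass 1, so the total mass 2 is the length of ]-1, 1[. The rate [2^-1] gives
    the reference measure of the change of variable, the rate [1 - a] the moment generating function
    of a coordinate. *)
Definition two_sided_exp (R : realType) (a x : R) : R := a * expR (- a * `|x|).

Section two_sided_exp.
Context (R : realType).
Implicit Types a b x : R.
Local Notation mu := (@lebesgue_measure R).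

Lemma two_sided_exp_ge0 a x : 0 <= a -> 0 <= two_sided_exp a x.
Proof. by move=> a0; rewrite mulr_ge0// expR_ge0. Qed.

Lemma continuous_two_sided_exp a : continuous (two_sided_exp a).
Proof.
move=> x; apply: cvgM; first exact: cvg_cst.
apply: (continuous_comp (f := fun x => - a * `|x|)); last exact: continuous_expR.
by apply: cvgM; [exact: cvg_cst|exact: norm_continuous].
Qed.

Lemma measurable_two_sided_exp a : measurable_fun setT (two_sided_exp a).
Proof. by apply: continuous_measurable_fun; exact: continuous_two_sided_exp. Qed.

Lemma integral_two_sided_exp_right a b : 0 < a -> 0 <= b ->
  (\int[mu]_(x in `[b, +oo[) (two_sided_exp a x)%:E = (expR (- a * b))%:E)%E.
Proof.
move=> a0 b0.
have cE : continuous (fun x : R => expR (- a * x)).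
  move=> x; apply: (continuous_comp (f := fun x => - a * x)); last exact: continuous_expR.
  by apply: cvgM; [exact: cvg_cst|exact: cvg_id].
transitivity (\int[mu]_(x in `[b, +oo[) (a * expR (- a * x))%:E)%E.
  apply: eq_integral => x; rewrite inE/= in_itv/= andbT => bx.
  by rewrite /two_sided_exp ger0_norm// (le_trans b0).
rewrite (@ge0_continuous_FTC2y _ _ (fun x => - (expR (- a * x))) _ 0)//.
- by rewrite sub0e EFinN oppeK.
- by move=> x _; rewrite mulr_ge0 ?expR_ge0// ltW.
- by apply: continuous_subspaceT => x; apply: cvgM; [exact: cvg_cst|exact: cE].
- rewrite -oppr0; apply: cvgN.
  rewrite (_ : (fun x => expR (- a * x)) =
               (fun z => expR (- z)) \o (fun z => a * z)); last first.
    by apply: eq_fun => x; rewrite mulNr.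
  apply: (@cvg_comp _ _ _ _ _ _ (pinfty_nbhs R)); last exact: cvgr_expR.
  exact: gt0_cvgMry.
- by apply: cvgN; apply/cvg_at_right_filter; exact: cE.
- move=> z _; rewrite derive1_comp// derive1N// derive1_id mulN1r derive1_comp// derive1E.
  have /funeqP -> := @derive_expR R.
  by rewrite derive1Ml// derive1_id mulr1 mulrN opprK mulrC.
Qed.

Lemma integral_two_sided_exp_left a b : 0 < a -> 0 <= b ->
  (\int[mu]_(x in `]-oo, (- b)%R]) (two_sided_exp a x)%:E = (expR (- a * b))%:E)%E.
Proof.
move=> a0 b0; rewrite ge0_integration_by_substitutionNy.
- rewrite -(integral_two_sided_exp_right a0 b0).
  by apply: eq_integral => x _; rewrite /two_sided_exp/= normrN.
- by apply: continuous_subspaceT; exact: continuous_two_sided_exp.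
- by move=> x _; apply: two_sided_exp_ge0; exact: ltW.
Qed.

Lemma integral_two_sided_exp a : 0 < a ->
  (\int[mu]_x (two_sided_exp a x)%:E = 2%:E)%E.
Proof.
move=> a0.
have mE : measurable_fun setT (EFin \o two_sided_exp a).
  by apply/measurable_EFinP; exact: measurable_two_sided_exp.
rewrite -(setUv `[0, +oo[%classic) ge0_integral_setU//=; last 4 first.
  exact: measurableC.
  by rewrite setUv.
  by move=> x _; rewrite lee_fin two_sided_exp_ge0// ltW.
  exact/disj_setPCl.
rewrite integral_two_sided_exp_right// setCitvr integral_itv_bndo_bndc; last first.
  exact: measurable_funTS.
have := integral_two_sided_exp_left a0 (lexx 0).
by rewrite oppr0 mulr0 expR0 => ->; rewrite -EFinD.
Qed.

(* The substitution [p = triang x] turns [two_sided_exp 2^-1 x dx] into Lebesgue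
   measure on ]-1, 1[ and the Laplace law into the triangular law. *)
Definition triang (x : R) : R := if 0 <= x then 1 - expR (- (2^-1 * x)) else expR (2^-1 * x) - 1.

Lemma triang_bound x : -1 < triang x < 1.
Proof.
rewrite /triang; case: ifPn => [x0|].
  have := expR_gt0 (- (2^-1 * x)).
  have : expR (- (2^-1 * x)) <= 1 by rewrite expR_le1; lra.
  by lra.
rewrite -ltNge => x0; have := expR_gt0 (2^-1 * x).
have : expR (2^-1 * x) <= 1 by rewrite expR_le1; lra.
by lra.
Qed.

Lemma increasing_triang x y : x < y -> triang x < triang y.
Proof.
move=> xy; rewrite /triang; case: ifPn => x0; case: ifPn => y0.
- by rewrite ltrD2l ltrN2 ltr_expR; lra.
- by move: y0; rewrite (le_trans x0)// ltW.
- have : expR (2^-1 * x) < 1 by rewrite expR_lt1; move: x0; rewrite -ltNge; lra.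
  have : expR (- (2^-1 * y)) <= 1 by rewrite expR_le1; lra.
  by lra.
- by rewrite ltrD2r ltr_expR; lra.
Qed.

Lemma le_triang x y : (triang x <= triang y) = (x <= y).
Proof. by apply: (le_mono increasing_triang). Qed.

Local Notation kappa U := (\int[mu]_(x in U) (two_sided_exp 2^-1 x)%:E)%E.

Let mk : measurable_fun setT (EFin \o @two_sided_exp R 2^-1).
Proof. by apply/measurable_EFinP; exact: measurable_two_sided_exp. Qed.

Let k0 x : (0 <= (two_sided_exp 2^-1 x)%:E)%E.
Proof. by rewrite lee_fin two_sided_exp_ge0. Qed.

Let half_gt0 : 0 < 2^-1 :> R. Proof. by []. Qed.

Let kappaS (U V : set R) : measurable U -> measurable V -> U `<=` V -> (kappa U <= kappa V)%E.
Proof. by move=> mU mV UV; apply: ge0_subset_integral => //; exact: measurable_funTS. Qed.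

Let kappaC (U : set R) : measurable U -> (kappa U + kappa (~` U) = 2%:E)%E.
Proof.
move=> mU; rewrite -(integral_two_sided_exp half_gt0) -[in RHS](setUv U).
rewrite ge0_integral_setU//.
- exact: measurableC.
- by rewrite setUv.
- exact/disj_setPCl.
Qed.

(** Up to an additive constant, [triang] is the distribution function of the reference measure; this
    is why it carries that measure to Lebesgue measure. *)
Let kappa_right b : (kappa `[b, +oo[ = (1 - triang b)%:E)%E.
Proof.
rewrite /triang; case: ifPn => [b0|].
  by rewrite integral_two_sided_exp_right//; congr EFin; rewrite mulNr; lra.
rewrite -ltNge => b0.
have := @kappaC `[b, +oo[ (measurable_itv _).
rewrite setCitvr integral_itv_bndo_bndc; last exact: measurable_funTS.
have := @integral_two_sided_exp_left 2^-1 (- b) half_gt0.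
rewrite opprK => -> //; last by lra.
move=> /(congr1 (fun z : \bar R => z - (expR (- 2^-1 * - b))%:E)%E).
rewrite addeK// => ->; rewrite -EFinB; congr EFin.
by rewrite mulrNN; lra.
Qed.

Let kappa_left b : (kappa `]-oo, b] = (1 + triang b)%:E)%E.
Proof.
have := @kappaC `[b, +oo[ (measurable_itv _).
rewrite setCitvr integral_itv_bndo_bndc; last exact: measurable_funTS.
rewrite kappa_right addeC.
move=> /(congr1 (fun z : \bar R => z - (1 - triang b)%:E)%E).
by rewrite addeK// => ->; rewrite -EFinB; congr EFin; lra.
Qed.

Lemma triang_surj M : -1 < M < 1 -> exists b, triang b = M.
Proof.
move=> M1; have [M0|M0] := leP 0 M.
  have h : 0 < 1 - M by lra.
  exists (- (2 * ln (1 - M))); rewrite /triang ifT; last first.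
    by rewrite oppr_ge0 pmulr_rle0// ln_le0//; lra.
  by rewrite mulrN opprK mulrA mulVf ?mul1r ?lnK//; lra.
have h : 0 < 1 + M by lra.
exists (2 * ln (1 + M)); rewrite /triang ifF; last first.
  by apply/negbTE; rewrite -ltNge pmulr_rlt0// ln_lt0//; lra.
by rewrite mulrA mulVf ?mul1r ?lnK//; lra.
Qed.

(** The form in which the change of variable is used: images of level sets are only enclosed in
    intervals. The endpoints 1 and -1 have no preimage under [triang], so they are treated apart, by
    comparison with half-lines or the whole line. *)
Lemma triang_band_le (U : set R) m M : measurable U -> U !=set0 ->
  (forall x, U x -> m <= triang x <= M) -> -1 <= m -> M <= 1 ->
  (kappa U <= (M - m)%:E)%E.
Proof.
move=> mU [u Uu] UmM m1 M1.
have [ub uM] : m <= triang u /\ triang u <= M by apply/andP; exact: UmM.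
have /andP[u1 u2] := triang_bound u.
have [M11|M1'] := ltP M 1; last first.
  have {M1 M1'}M1 : M = 1 by lra.
  have [m11|m1'] := ltP (-1) m; last first.
    have -> : M - m = 2 by lra.
    by rewrite -(integral_two_sided_exp half_gt0); exact: kappaS.
  have [|a am] := @triang_surj m; first by lra.
  rewrite M1 -am -kappa_right; apply: kappaS => // x Ux /=; rewrite in_itv/= andbT.
  by rewrite -le_triang am; have /andP[] := UmM _ Ux.
have [|b bM] := @triang_surj M; first by lra.
have [m11|m1'] := ltP (-1) m; last first.
  have -> : M - m = 1 + M by lra.
  rewrite -bM -kappa_left; apply: kappaS => // x Ux /=; rewrite in_itv/=.
  by rewrite -le_triang bM; have /andP[] := UmM _ Ux.
have [|a am] := @triang_surj m; first by lra.
have ab : a <= b by rewrite -le_triang am bM; lra.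
apply: (@le_trans _ _ (kappa `[a, b])).
  apply: kappaS => // x Ux /=; rewrite in_itv/=.
  by rewrite -(le_triang a) -(le_triang x) am bM; exact: UmM.
have : (kappa `]-oo, b] = kappa `]-oo, a[ + kappa `[a, b])%E.
  rewrite -ge0_integral_setU//; last 2 first.
  - exact: measurable_funTS.
  - apply/disj_set2P; rewrite -subset0 => x [/=]; rewrite !in_itv/= => xa /andP[ax _].
    by move: xa; rewrite ltNge ax.
  congr (integral _ _ _); rewrite predeqE => x; split => /=; rewrite !in_itv/=.
    by move=> xb; case: (ltP x a); [left|right].
  by move=> [/ltW xa|/andP[]//]; exact: le_trans ab.
rewrite integral_itv_bndo_bndc; last exact: measurable_funTS.
rewrite !kappa_left am bM addeC.
move=> /(congr1 (fun z : \bar R => z - (1 + m)%:E)%E).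
by rewrite addeK// => <-; rewrite -EFinB lee_fin; lra.
Qed.
End two_sided_exp.

(** * The product inequality in dimension one *)

Definition quarter_cosh (R : realType) (u : R) : R := (expR (4^-1 * u) + expR (- (4^-1 * u))) / 2.

Section one_dim.
Context (R : realType).
Implicit Types x y : R.
Local Notation mu := (@lebesgue_measure R).
Local Notation kappa U := (\int[mu]_(x in U) (two_sided_exp 2^-1 x)%:E)%E.

Let mk : measurable_fun setT (EFin \o @two_sided_exp R 2^-1).
Proof. by apply/measurable_EFinP; exact: measurable_two_sided_exp. Qed.

Let k0 x : 0 <= two_sided_exp 2^-1 x.
Proof. by rewrite two_sided_exp_ge0. Qed.

(** Put [a = exp (- |x| / 2)] and [b = exp (- |y| / 2)]. For equal signs both sides are
    [(a + b) / 2], which is what dictates the cost [cosh (u / 4)]. For opposite signs the claim is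
    [1 + a b + |a - b| <= 2], that is [(1 - a) (1 + b) >= 0] or its mirror image. *)
Lemma quarter_cosh_triang x y :
  expR (- (4^-1 * (`|x| + `|y|))) * quarter_cosh (x - y) <=
  1 - `|triang x + triang y| / 2.
Proof.
rewrite /quarter_cosh mulrA ler_pdivrMr// mulrDr -!expRD /triang.
case: ifPn => [x0|]; case: ifPn => [y0|].
- rewrite !ger0_norm//; last first.
    have : expR (- (2^-1 * x)) <= 1 by rewrite expR_le1; lra.
    have : expR (- (2^-1 * y)) <= 1 by rewrite expR_le1; lra.
    lra.
  rewrite [X in expR X + expR _](_ : _ = - (2^-1 * y)); last by lra.
  rewrite [X in _ + expR X <= _](_ : _ = - (2^-1 * x)); last by lra.
  by lra.
- rewrite -ltNge => y0; rewrite (ger0_norm x0) (ltr0_norm y0).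
  rewrite [X in expR X + expR _](_ : _ = 0); last by lra.
  rewrite [X in _ + expR X <= _](_ : _ = - (2^-1 * x) + 2^-1 * y); last by lra.
  rewrite expR0 expRD.
  have : expR (- (2^-1 * x)) <= 1 by rewrite expR_le1; lra.
  have : expR (2^-1 * y) <= 1 by rewrite expR_le1; lra.
  have := expR_gt0 (- (2^-1 * x)); have := expR_gt0 (2^-1 * y).
  move: (expR _) (expR _) => a b a0 b0 a1 b1.
  by case: (ler0P (1 - a + (b - 1))) => h; nra.
- rewrite -ltNge => x0; rewrite (ger0_norm y0) (ltr0_norm x0).
  rewrite [X in expR X + expR _](_ : _ = - (2^-1 * y) + 2^-1 * x); last by lra.
  rewrite [X in _ + expR X <= _](_ : _ = 0); last by lra.
  rewrite expR0 expRD.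
  have : expR (- (2^-1 * y)) <= 1 by rewrite expR_le1; lra.
  have : expR (2^-1 * x) <= 1 by rewrite expR_le1; lra.
  have := expR_gt0 (- (2^-1 * y)); have := expR_gt0 (2^-1 * x).
  move: (expR _) (expR _) => a b a0 b0 a1 b1.
  by case: (ler0P (b - 1 + (1 - a))) => h; nra.
- rewrite -!ltNge => y0 x0; rewrite (ltr0_norm y0) (ltr0_norm x0).
  rewrite [`|_ + _|]ler0_norm; last first.
    have : expR (2^-1 * x) <= 1 by rewrite expR_le1; lra.
    have : expR (2^-1 * y) <= 1 by rewrite expR_le1; lra.
    lra.
  rewrite [X in expR X + expR _](_ : _ = 2^-1 * x); last by lra.
  rewrite [X in _ + expR X <= _](_ : _ = 2^-1 * y); last by lra.
  by lra.
Qed.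

(** The hypothesis gives [sup + sup <= 2 * r] and [inf + inf >= - 2 * r] for the two images, so the
    widths of the enclosing intervals add up to at most [4 * r]. An empty set would leave the other
    one unconstrained. *)
Lemma triang_pair_le (U V : set R) (r : R) : measurable U -> measurable V ->
  U !=set0 -> V !=set0 ->
  (forall x y, U x -> V y -> `|triang x + triang y| <= 2 * r) ->
  (kappa U + kappa V <= (4 * r)%:E)%E.
Proof.
move=> mU mV U0 V0 UV.
have bnd (W : set R) : measurable W -> W !=set0 ->
  [/\ has_sup (@triang R @` W), has_inf (@triang R @` W) &
   (kappa W <= (sup (@triang R @` W) - inf (@triang R @` W))%:E)%E].
  move=> mW W0.
  have hs : has_sup (@triang R @` W).
    split; first exact: image_nonempty.
    by exists 1 => _ [x _ <-]; have /andP[_ /ltW] := triang_bound x.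
  have hi : has_inf (@triang R @` W).
    split; first exact: image_nonempty.
    by exists (-1) => _ [x _ <-]; have /andP[/ltW] := triang_bound x.
  split => //; apply: triang_band_le => //.
  - move=> x Wx; apply/andP; split.
      by apply: ge_inf; [case: hi|exists x].
    by apply: ub_le_sup; [case: hs|exists x].
  - apply: lb_le_inf; first by case: hi.
    by move=> _ [x _ <-]; have /andP[/ltW] := triang_bound x.
  - apply: ge_sup; first by case: hs.
    by move=> _ [x _ <-]; have /andP[_ /ltW] := triang_bound x.
have [Us Ui kU] := bnd _ mU U0; have [Vs Vi kV] := bnd _ mV V0.
apply: (le_trans (leeD kU kV)); rewrite -EFinD lee_fin.
have s1 : sup (@triang R @` V) <= 2 * r - sup (@triang R @` U).
  apply: ge_sup; first by case: Vs.
  move=> _ [y Vy <-]; rewrite lerBrDr addrC -lerBrDr.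
  apply: ge_sup; first by case: Us.
  move=> _ [x Ux <-]; rewrite lerBrDr.
  exact: le_trans (ler_norm _) (UV _ _ Ux Vy).
have i1 : - (2 * r) - inf (@triang R @` U) <= inf (@triang R @` V).
  apply: lb_le_inf; first by case: Vi.
  move=> _ [y Vy <-]; rewrite lerBlDr addrC -lerBlDr.
  apply: lb_le_inf; first by case: Ui.
  move=> _ [x Ux <-]; rewrite lerBlDr.
  by have := UV _ _ Ux Vy; rewrite ler_norml => /andP[].
lra.
Qed.

(** Layer-cake formula with levels rescaled by [alpha]. Taking for [alpha] the supremum, two
    functions are cut at the same fraction [t] of their suprema, and for [t < 1] both level sets are
    nonempty. *)
Let layer (F : R -> R) (alpha : R) : measurable_fun setT F ->
  (forall x, 0 <= F x <= alpha) -> 0 < alpha ->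
  (\int[mu]_x (F x * two_sided_exp 2^-1 x)%:E =
   alpha%:E * \int[mu]_(t in `[0%R, 1%R[) kappa [set x | (alpha * t < F x)%R])%E /\
  measurable_fun (`[0, 1[%classic : set (measurableTypeR R)) (fun t : measurableTypeR R => kappa [set x | (alpha * t < F x)%R]).
Proof.
move=> mF F0a a0.
pose f (z : R * R) : \bar R := (if [&& 0 <= z.2, z.2 < 1 & alpha * z.2 < F z.1]
   then two_sided_exp 2^-1 z.1 else 0)%:E.
have mf : measurable_fun setT f.
  apply/measurable_EFinP; apply: measurable_fun_ifT => //.
  - apply: measurable_and; first exact: measurable_fun_ler.
    apply: measurable_and; first exact: measurable_fun_ltr.
    apply: measurable_fun_ltr; first exact: measurable_funM.
    exact: measurableT_comp.
  - apply: measurableT_comp => //; exact: measurable_two_sided_exp.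
have f0 z : (0 <= f z)%E by rewrite /f lee_fin; case: ifP.
have E1 : (fun t => \int[mu]_x f (x, t))%E =
    (fun t : R => kappa [set x | (alpha * t < F x)%R]) \_ `[0, 1[.
  apply/funext => t; rewrite patchE; case: ifPn => [|].
    rewrite inE/= in_itv/= => /andP[t0 t1].
    rewrite [RHS]integral_mkcond; apply: eq_integral => x _.
    rewrite /f /= t0 t1/= patchE; case: ifPn => [h|h].
      by rewrite ifT// inE.
    by rewrite ifF//; apply/negbTE; rewrite notin_setE/=; apply/negP.
  rewrite notin_setE/= in_itv/= => /negP h.
  by rewrite integral0_eq// => x _; rewrite /f/= andbA (negbTE h).
split.
  rewrite [X in _ = (_ * X)%E]integral_mkcond -E1.
  have <- := fubini_tonelli (m1 := mu) (m2 := mu) f mf f0.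
  rewrite -ge0_integralZl//=.
  - apply: eq_integral => x _.
    transitivity (alpha%:E * \int[mu]_(t in `[0%R, (F x / alpha)%R[) (two_sided_exp 2^-1 x)%:E)%E; last first.
      congr (_ * _)%E; rewrite integral_mkcond; apply: eq_integral => t _.
      rewrite patchE /f/= mem_setE in_itv/= ltr_pdivlMr// [t * _]mulrC.
      case: (leP 0 t) => //= t0; case: (ltP t 1) => //= t1; last first.
        rewrite ifF//; apply/negbTE; rewrite -leNgt.
        have /andP[_ h] := F0a x; rewrite (le_trans h)// ler_peMr// ltW//.
      by case: ifP.
    rewrite integral_cst//= lebesgue_measure_itv/= lte_fin.
    have /andP[F0 _] := F0a x.
    have [h|h] := ltP 0 (F x / alpha); last first.
      have -> : F x = 0.
        apply/eqP; rewrite eq_le F0 andbT.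
        by move: h; rewrite pmulr_lle0// invr_gt0.
      by rewrite mul0r mule0 mule0.
    rewrite sube0 -!EFinM; congr EFin; field.
    by rewrite gt_eqF.
  - exact: measurable_fun_fubini_tonelli_F.
  - by move=> x _; apply: integral_ge0.
  - by rewrite lee_fin ltW.
have : measurable_fun setT (fun t : measurableTypeR R => \int[mu]_x f (x, t))%E.
  exact: measurable_fun_fubini_tonelli_G.
rewrite E1 => H; apply/(@measurable_restrictT _ _ (measurableTypeR R) _ _ _) => //.
Qed.

Let integral_affine (c : R) :
  (\int[mu]_(t in `[0%R, 1%R[) (4 * (1 - c * t))%:E = (4 - 2 * c)%:E)%E.
Proof.
have cf : continuous (fun t : R => 4 * (1 - c * t)).
  move=> t; apply: cvgM; first exact: cvg_cst.
  apply: cvgB; first exact: cvg_cst.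
  by apply: cvgM; [exact: cvg_cst|exact: cvg_id].
pose H (t : R) := 4 * t - 2 * c * (t * t).
have dH (t : R) : is_derive t 1 H (4 * (1 - c * t)).
  rewrite /H; apply: is_derive_eq; rewrite /GRing.scale/=; ring.
have cH : continuous H.
  by move=> t; apply: differentiable_continuous; apply/derivable1_diffP.
rewrite integral_itv_bndo_bndc; last first.
  by apply/measurable_EFinP; apply: measurable_funTS; exact: continuous_measurable_fun.
rewrite (@continuous_FTC2 _ _ H)//.
- by rewrite /H -EFinB; congr EFin; ring.
- exact: continuous_subspaceT.
- split.
  + by move=> t _.
  + by apply/cvg_at_right_filter; exact: cH.
  + by apply/cvg_at_left_filter; exact: cH.
- by move=> t _; rewrite derive1E derive_val.
Qed.

(* This is Prekopa-Leindler for the concave density [1 - |p|], whose superlevel sets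
   are intervals: two level sets whose midpoints all lie in an interval lie in
   intervals themselves, so no Brunn-Minkowski inequality is needed. *)
Lemma integral_triang_mul (F G : R -> R) :
  measurable_fun setT F -> measurable_fun setT G ->
  (forall x, 0 <= F x) -> (forall x, 0 <= G x) ->
  (forall x y, F x * G y <= (1 - `|triang x + triang y| / 2) ^+ 2) ->
  ((\int[mu]_x (F x * two_sided_exp 2^-1 x)%:E) *
   (\int[mu]_x (G x * two_sided_exp 2^-1 x)%:E) <= 1)%E.
Proof.
move=> mF mG F0 G0 FG.
have [[x0 Fx0]|noF] := pselect (exists x, 0 < F x); last first.
  rewrite [X in (X * _)%E]integral0_eq ?mul0e// => x _.
  have -> : F x = 0 by apply/eqP; rewrite eq_le F0 leNgt andbT; apply/negP => ?; apply: noF; exists x.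
  by rewrite mul0r.
have [[y0 Gy0]|noG] := pselect (exists x, 0 < G x); last first.
  rewrite [X in (_ * X)%E]integral0_eq ?mule0// => x _.
  have -> : G x = 0 by apply/eqP; rewrite eq_le G0 leNgt andbT; apply/negP => ?; apply: noG; exists x.
  by rewrite mul0r.
have H0 x y : 0 <= 1 - `|triang x + triang y| / 2.
  have /andP[? ?] := triang_bound x; have /andP[? ?] := triang_bound y.
  by case: (ler0P (triang x + triang y)) => h; lra.
have FG1 x y : F x * G y <= 1.
  by rewrite (le_trans (FG x y))// exprn_ile1// gerBl mulr_ge0.
have rF : range F !=set0 by exists (F x0), x0.
have rG : range G !=set0 by exists (G y0), y0.
(* A single positive value of [G] bounds [F], since the product is at most 1. *)
have sF : has_sup (range F).
  by split => //; exists (G y0)^-1 => _ [x _ <-]; rewrite -[_^-1]mul1r ler_pdivlMr.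
have sG : has_sup (range G).
  split => //; exists (F x0)^-1 => _ [y _ <-].
  by rewrite -[_^-1]mul1r ler_pdivlMr// mulrC.
set al := sup (range F); set be := sup (range G).
have Fal x : F x <= al by apply: ub_le_sup; [case: sF|exists x].
have Gbe x : G x <= be by apply: ub_le_sup; [case: sG|exists x].
have al0 : 0 < al by apply: lt_le_trans (Fal x0).
have be0 : 0 < be by apply: lt_le_trans (Gbe y0).
have albe : al * be <= 1.
  rewrite -ler_pdivlMr//; apply: ge_sup => // _ [x _ <-].
  have [->|Fx] := eqVneq (F x) 0; first by rewrite divr_ge0// ltW.
  have {}Fx : 0 < F x by rewrite lt_neqAle eq_sym Fx F0.
  rewrite ler_pdivlMr// mulrC -ler_pdivlMr//; apply: ge_sup => // _ [y _ <-].
  by rewrite ler_pdivlMr// mulrC FG1.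
(* On the level sets at fraction [t], [(g * t) ^ 2 <= F x * G y], so [1 - |p|] is at least [g * t]
   at the midpoint [p] of the images; [triang_pair_le] then applies with [1 - g * t]. *)
pose g := Num.sqrt (al * be).
have g0 : 0 <= g by exact: sqrtr_ge0.
have gg : g ^+ 2 = al * be by rewrite sqr_sqrtr// mulr_ge0// ltW.
have g1 : g <= 1 by rewrite -(@expr_le1 _ 2)// gg.
have [|IF mIF] := @layer F al mF _ al0; first by move=> x; rewrite F0 Fal.
have [|IG mIG] := @layer G be mG _ be0; first by move=> x; rewrite G0 Gbe.
rewrite IF IG.
set JF := (\int[mu]_(t in _) _)%E; set JG := (X in (_ * (_ * X))%E).
have mU (K : R -> R) (c : R) : measurable_fun setT K -> measurable [set x | c < K x].
  move=> mK; rewrite (_ : [set x | _] = [set: R] `&` K @^-1` `]c, +oo[); last first.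
    by rewrite setTI; apply/seteqP; split => x /=; rewrite in_itv/= andbT.
  exact: mK.
have JF0 : (0 <= JF)%E.
  by apply: integral_ge0 => t _; apply: integral_ge0 => x _; rewrite lee_fin.
have JG0 : (0 <= JG)%E.
  by apply: integral_ge0 => t _; apply: integral_ge0 => x _; rewrite lee_fin.
have JFG : (JF + JG <= (4 - 2 * g)%:E)%E.
  rewrite -integral_affine -ge0_integralD//; last 2 first.
  - by move=> t _; apply: integral_ge0 => x _; rewrite lee_fin.
  - by move=> t _; apply: integral_ge0 => x _; rewrite lee_fin.
  apply: ge0_le_integral => //.
  - by move=> t _; apply: adde_ge0; apply: integral_ge0 => x _; rewrite lee_fin.
  - exact: emeasurable_funD.
  - apply/measurable_EFinP; apply: measurable_funM => //.
    by apply: measurable_funB => //; exact: measurable_funM.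
  move=> t /=; rewrite in_itv/= => /andP[t0 t1].
  have near_sup (K : R -> R) (c : R) : has_sup (range K) -> 0 < sup (range K) ->
      [set x | sup (range K) * t < K x] !=set0.
    move=> hK sK.
    have [|_ [x _ <-] h] := sup_adherent (_ : 0 < sup (range K) * (1 - t)) hK.
      by rewrite mulr_gt0// subr_gt0.
    by exists x => /=; apply: le_lt_trans h; lra.
  apply: triang_pair_le => //.
  - exact: mU.
  - exact: mU.
  - exact: near_sup.
  - exact: near_sup.
  move=> x y /= Fx Gy.
  have : g * t <= 1 - `|triang x + triang y| / 2.
    rewrite -(@ler_pXn2r _ 2)//; last 2 first.
      by rewrite nnegrE mulr_ge0.
      by rewrite nnegrE.
    rewrite (le_trans _ (FG x y))// exprMn gg.
    rewrite [X in X <= _](_ : _ = (al * t) * (be * t)); last by ring.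
    by apply: ler_pM; rewrite ?mulr_ge0// ltW.
  by lra.
have JFf : JF \is a fin_num.
  rewrite ge0_fin_numE//; apply: le_lt_trans (ltry (4 - 2 * g)).
  by apply: le_trans JFG; rewrite leeDl.
have JGf : JG \is a fin_num.
  rewrite ge0_fin_numE//; apply: le_lt_trans (ltry (4 - 2 * g)).
  by apply: le_trans JFG; rewrite leeDr.
move: JFG JF0 JG0; rewrite -(fineK JFf) -(fineK JGf) -EFinD -!EFinM !lee_fin.
move: (fine JF) (fine JG) => a b ab a0 b0.
have -> : al * a * (be * b) = g ^+ 2 * (a * b) by rewrite gg; ring.
(* By the arithmetic-geometric mean inequality. The product of the integrals is then at most
   [(g * (2 - g)) ^ 2], and [g * (2 - g) <= 1]. *)
have h1 : a * b <= (2 - g) ^+ 2.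
  apply: (@le_trans _ _ (((a + b) / 2) ^+ 2)).
    by have := sqr_ge0 (a - b); nra.
  by rewrite ler_pXn2r// ?nnegrE; lra.
apply: (@le_trans _ _ (g ^+ 2 * (2 - g) ^+ 2)).
  by rewrite ler_wpM2l// sqr_ge0.
by rewrite -exprMn exprn_ile1//; nra.
Qed.

End one_dim.

Section quarter_cosh.
Context (R : realType).
Implicit Types u : R.

Lemma quarter_cosh_gt0 u : 0 < quarter_cosh u.
Proof. by rewrite divr_gt0// addr_gt0// expR_gt0. Qed.

Definition laplace_pdf u : R := expR (- `|u|) / 2.

Lemma laplace_pdf_ge0 u : 0 <= laplace_pdf u.
Proof. by rewrite divr_ge0// expR_ge0. Qed.

Lemma measurable_laplace_pdf : measurable_fun setT laplace_pdf.
Proof.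
apply: measurable_funM => //; apply: measurableT_comp => //.
by apply: measurable_funN; exact: normr_measurable.
Qed.

(** The Laplace density is [exp (- |x| / 2)] times the reference density; moved into the functions,
    this factor combines with the cost through [quarter_cosh_triang]. Infinite values are allowed
    because the lemma is applied to partial averages not known to be finite. *)
Lemma laplace_integral_mul (m : {measure set (measurableTypeR R) -> \bar R})
    (A B : R -> \bar R) (c : R) :
  (forall V, measurable V -> m V = density_measure (@lebesgue_measure R) laplace_pdf V) ->
  measurable_fun setT A -> measurable_fun setT B ->
  (forall x, 0 <= A x)%E -> (forall x, 0 <= B x)%E -> 0 < c ->
  (forall x y, A x * B y <= (c * quarter_cosh (x - y) ^+ 2)%:E)%E ->
  ((\int[m]_x A x) * (\int[m]_x B x) <= c%:E)%E.
Proof.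
move=> mE mA mB A0 B0 c0 AB.
have zero (D : R -> \bar R) : (forall x, D x = 0)%E -> (\int[m]_x D x = 0)%E.
  by move=> D0; rewrite integral0_eq.
(* The right-hand side is finite, so one infinite value of [A] makes [B] vanish identically, and
   likewise with the roles exchanged. *)
have zeroB x : A x = +oo%E -> forall y, B y = 0%E.
  move=> Ax y; apply/eqP; rewrite eq_le B0 andbT leNgt; apply/negP => By.
  by have := AB x y; rewrite Ax gt0_mulye// leNgt ltry.
have zeroA y : B y = +oo%E -> forall x, A x = 0%E.
  move=> By x; apply/eqP; rewrite eq_le A0 andbT leNgt; apply/negP => Ax.
  by have := AB x y; rewrite By gt0_muley// leNgt ltry.
have [[x Ax]|Afin] := pselect (exists x, A x = +oo%E).
  by rewrite (zero B (zeroB x Ax)) mule0 lee_fin ltW.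
have [[y By]|Bfin] := pselect (exists x, B x = +oo%E).
  by rewrite (zero A (zeroA y By)) mul0e lee_fin ltW.
have Af x : A x \is a fin_num.
  by rewrite ge0_fin_numE// ltey; apply/eqP => h; apply: Afin; exists x.
have Bf x : B x \is a fin_num.
  by rewrite ge0_fin_numE// ltey; apply/eqP => h; apply: Bfin; exists x.
have mm (D : R -> \bar R) : measurable_fun setT D -> measurable_fun setT (fine \o D).
  by move=> mD; exact: measurableT_comp.
have me : measurable_fun setT (fun x : R => expR (- (2^-1 * `|x|))).
  apply: measurableT_comp => //; apply: measurable_funN.
  by apply: measurable_funM => //; exact: normr_measurable.
have split_pdf x : laplace_pdf x = expR (- (2^-1 * `|x|)) * two_sided_exp 2^-1 x.
  rewrite /laplace_pdf /two_sided_exp mulrCA -expRD mulrC; congr (_ * expR _).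
  by rewrite mulNr; lra.
have IE (D : R -> \bar R) : (forall x, 0 <= D x)%E -> (forall x, D x \is a fin_num) ->
   measurable_fun setT D ->
  (\int[m]_x D x = \int[@lebesgue_measure R]_x
     ((fine (D x) * expR (- (2^-1 * `|x|))) * two_sided_exp 2^-1 x)%:E)%E.
  move=> D0 Df mD.
  rewrite (@ge0_integral_density _ _ _ (@lebesgue_measure R) laplace_pdf)//.
  - apply: eq_integral => x _; rewrite -[in LHS](fineK (Df x)) -EFinM split_pdf.
    by rewrite mulrA.
  - exact: measurable_laplace_pdf.
  - exact: laplace_pdf_ge0.
rewrite IE// IE//.
pose F x := c^-1 * (fine (A x) * expR (- (2^-1 * `|x|))).
pose G x := fine (B x) * expR (- (2^-1 * `|x|)).
have mF : measurable_fun setT F.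
  by apply: measurable_funM => //; apply: measurable_funM => //; exact: mm.
have mG : measurable_fun setT G by apply: measurable_funM => //; exact: mm.
have F0 x : 0 <= F x.
  by rewrite mulr_ge0 ?invr_ge0 ?(ltW c0)// mulr_ge0 ?fine_ge0 ?expR_ge0.
have G0 x : 0 <= G x by rewrite mulr_ge0 ?fine_ge0 ?expR_ge0.
have H0 (x y : R) : 0 <= 1 - `|triang x + triang y| / 2.
  have /andP[? ?] := triang_bound x; have /andP[? ?] := triang_bound y.
  by case: (ler0P (triang x + triang y)) => h; lra.
have := integral_triang_mul mF mG F0 G0.
rewrite [X in (X * _)%E](_ : _ = c^-1%:E * \int[@lebesgue_measure R]_x
     ((fine (A x) * expR (- (2^-1 * `|x|))) * two_sided_exp 2^-1 x)%:E)%E; last first.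
  rewrite -ge0_integralZl//.
  - by apply: eq_integral => x _; rewrite /F -EFinM !mulrA.
  - apply/measurable_EFinP; apply: measurable_funM; last exact: measurable_two_sided_exp.
    by apply: measurable_funM => //; exact: (mm A).
  - by move=> x _; rewrite lee_fin mulr_ge0 ?two_sided_exp_ge0// mulr_ge0 ?fine_ge0 ?expR_ge0.
  - by rewrite lee_fin invr_ge0 ltW.
rewrite -muleA lee_pdivrMl ?mule1//; apply => x y.
apply: (@le_trans _ _ ((expR (- (4^-1 * (`|x| + `|y|))) * quarter_cosh (x - y)) ^+ 2)); last first.
  rewrite ler_pXn2r ?quarter_cosh_triang// nnegrE ?H0//.
  by rewrite mulr_ge0 ?expR_ge0// ltW// quarter_cosh_gt0.
rewrite exprMn -expRM_natl /F /G.
have /= := AB x y; rewrite -(fineK (Af x)) -(fineK (Bf y)) -EFinM lee_fin.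
move: (fine (A x)) (fine (B y)) => a b ab.
rewrite [X in X <= _](_ : _ = c^-1 * (expR (2%:R * - (4^-1 * (`|x| + `|y|))) * (a * b))); last first.
  rewrite (_ : 2%:R * - (4^-1 * (`|x| + `|y|)) = - (2^-1 * `|x|) - (2^-1 * `|y|)); last by lra.
  by rewrite expRD /=; ring.
rewrite ler_pdivrMl// [X in _ <= X]mulrCA ler_wpM2l ?expR_ge0//.
Qed.
End quarter_cosh.

(** * Independence and iterated integrals *)

Section independence.
Context (dT : measure_display) (T : measurableType dT) (R : realType) (P : probability T R).
Local Open Scope ereal_scope.

(** The product rule on rectangles identifies the law of the pair with a product measure, and
    Tonelli concludes. The space [E] is arbitrary so that [U] can be the identity of [T] onto a
    coarser sigma-algebra. *)
Lemma integral_indep_pair (dE dF : measure_display) (E : measurableType dE)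
    (F : measurableType dF) (U : {mfun T >-> E}) (V : {mfun T >-> F}) (f : E * F -> \bar R) :
  (forall C B, measurable C -> measurable B ->
    P (U @^-1` C `&` V @^-1` B) = P (U @^-1` C) * P (V @^-1` B)) ->
  measurable_fun setT f -> (forall z, 0 <= f z) ->
  \int[P]_w f (U w, V w) = \int[distribution P V]_t \int[P]_w f (U w, t).
Proof.
move=> UV mf f0.
have mUV : measurable_fun setT (fun w => (U w, V w)) by exact: measurable_fun_pair.
pose W : {mfun T >-> (E * F)%type} := mfun_Sub (mem_set mUV).
transitivity (\int[distribution P W]_z f z).
  by rewrite ge0_integral_distribution//.
transitivity (\int[(distribution P U \x distribution P V)]_z f z).
  apply: eq_measure_integral => A mA _; apply/esym/product_measure_unique => [B C mB mC|//].
  exact: UV.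
rewrite fubini_tonelli2//; apply: eq_integral => t _.
rewrite /fubini_G ge0_integral_distribution//; exact: measurableT_comp.
Qed.

(** The trace of [P] on [D] and [P] scaled by [P D] are finite measures agreeing on a class stable
    under intersection and containing [setT], hence on the sigma-algebra it generates. *)
Lemma indep_g_sigma (G : set (set T)) (D : set T) :
  G `<=` measurable -> setI_closed G -> G setT -> measurable D ->
  (forall C, G C -> P (C `&` D) = P C * P D) ->
  forall C, <<s G >> C -> P (C `&` D) = P C * P D.
Proof.
move=> mG GI GT mD GD C GC.
have PD0 : (0 <= fine (P D))%R by rewrite fine_ge0.
have := @g_sigma_algebra_measure_unique _ _ _ G mG (fun=> setT) (fun=> GT) _
  (mrestr P mD) (mscale (NngNum PD0) P) GI _ _ C GC.
have scE A : mscale (NngNum PD0) P A = P A * P D.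
  by rewrite /mscale/= fineK ?fin_num_measure// muleC.
rewrite -scE; apply.
- by rewrite bigcup_const.
- by move=> A GA; rewrite [RHS]scE -GD.
- move=> _; change (P (setT `&` D) < +oo).
  by rewrite setTI -ge0_fin_numE// fin_num_measure.
Qed.

End independence.

(** * Tensorization over the coordinates *)

(** Measurability is tested on coordinatewise measurable maps from an arbitrary space, since [A] is
    composed with maps from [T], from [T * R], and from the product of a coarser copy of [T] with
    [R]. *)
Definition coord_measurable (R : realType) (n : nat) (A : 'rV[R]_n -> R) :=
  forall dU (U : measurableType dU) (phi : 'I_n -> U -> R),
    (forall i, measurable_fun setT (phi i)) ->
    measurable_fun setT (fun w => A (\row_i phi i w)).

Section tensorization.
Context (dT : measure_display) (T : measurableType dT) (R : realType)
  (P : probability T R) (n : nat) (X : 'I_n -> T -> R).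
Hypothesis lapX : std_laplace_vector P X.
Implicit Types (A B : 'rV[R]_n -> R) (x y : 'rV[R]_n).

Let mX i : measurable_fun setT (X i). Proof. by case: lapX => /(_ i)[]. Qed.
Let Xf i : {mfun T >-> measurableTypeR R} :=
  @mfun_Sub _ _ T (measurableTypeR R) (X i) (mem_set (mX i)).

Let mix (k : nat) x w : 'rV[R]_n := \row_i (if (i < k)%N then x ord0 i else X i w).
Let upd (k : 'I_n) x (t : R) : 'rV[R]_n := \row_i (if i == k then t else x ord0 i).
(** [avg A n] is [A] itself and [avg A 0] the full expectation; coordinates are integrated from the
    last to the first. *)
Let avg A (k : nat) x := (\int[P]_w (A (mix k x w))%:E)%E.

(* The coordinates after [k] generate the sigma-algebra that is independent of
   [X k] and for which [avg A k.+1] is an integral with [x] frozen up to [k]. *)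
Let future (k : 'I_n) : set (set T) := [set C | exists B : 'I_n -> set R,
  [/\ forall i, measurable (B i), forall i : 'I_n, (i <= k)%N -> B i = setT &
      C = \bigcap_(i in [set: 'I_n]) (X i @^-1` B i)]].

Let measurable_future k : future k `<=` measurable.
Proof.
move=> _ [B [mB _ ->]]; apply: fin_bigcap_measurable => // i _.
by rewrite -[X in measurable X]setTI; exact: mX.
Qed.

Let future_setI k : setI_closed (future k).
Proof.
move=> _ _ [B [mB kB ->]] [C [mC kC ->]]; exists (fun i => B i `&` C i); split.
- by move=> i; exact: measurableI.
- by move=> i ik; rewrite kB// kC// setTI.
- by rewrite -bigcapI.
Qed.

Let future_setT k : future k setT.
Proof.
exists (fun=> setT); split => //.
by apply/seteqP; split => // w _ i _.
Qed.

Let measurable_id_future k : measurable_fun setT (id : T -> g_sigma_algebraType (future k)).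
Proof.
move=> _ C mC; rewrite setTI preimage_id.
exact: (smallest_sub (@sigma_algebra_measurable _ T) (@measurable_future k)).
Qed.

Let measurable_X_future (k i : 'I_n) : (k < i)%N ->
  measurable_fun setT (X i : g_sigma_algebraType (future k) -> R).
Proof.
move=> ki _ C mC; rewrite setTI; apply: sub_sigma_algebra.
exists (fun j => if j == i then C else setT); split.
- by move=> j; case: ifP.
- by move=> j jk; rewrite ifF//; apply/negbTE/eqP => ji; move: ki; rewrite -ji ltnNge jk.
- apply/seteqP; split => w.
    by move=> Cw j _ /=; case: ifP => [/eqP ->|].
  by move=> /(_ i Logic.I)/=; rewrite eqxx.
Qed.

Let future_indep (k : 'I_n) (D : set R) C : measurable D -> future k C ->
  (P (C `&` X k @^-1` D) = P C * P (X k @^-1` D))%E.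
Proof.
move=> mD [B [mB kB ->]]; have [_ indX] := lapX.
rewrite (indX B mB).
rewrite (_ : _ `&` _ = \bigcap_(i in [set: 'I_n]) (X i @^-1` (if i == k then D else B i))); last first.
  apply/seteqP; split => w.
    by move=> [Bw Dw] i _ /=; case: ifP => [/eqP ->//|_]; exact: Bw.
  move=> h; split => [i _|]; last by have := h k Logic.I; rewrite /= eqxx.
  by have := h i Logic.I; rewrite /=; case: ifP => [/eqP ->|//]; rewrite kB.
rewrite indX; last by move=> i; case: ifP.
rewrite (bigD1 k)//= [in RHS](bigD1 k)//= eqxx kB// preimage_setT probability_setT mul1e.
rewrite muleC; congr (_ * _)%E; apply: eq_bigr => i ik.
by rewrite (negbTE ik).
Qed.

(** The map [U] of the proof is the identity of [T] onto the sigma-algebra generated by [future k].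
    It is independent of [X k], so the integral over [X k] can be put outside. *)
Let avg_step A (k : 'I_n) x : coord_measurable A -> (forall z, 0 <= A z) ->
  (avg A k x = \int[distribution P (Xf k)]_t avg A k.+1 (upd k x t))%E.
Proof.
move=> mA A0.
pose U : {mfun T >-> g_sigma_algebraType (future k)} := mfun_Sub (mem_set (@measurable_id_future k)).
pose phi (i : 'I_n) (z : g_sigma_algebraType (future k) * R) : R :=
  if (i < k.+1)%N then (if i == k then z.2 else x ord0 i) else X i z.1.
have mphi i : measurable_fun setT (phi i).
  rewrite /phi; case ik : (i < k.+1)%N; last first.
    apply: (measurableT_comp (f := X i : g_sigma_algebraType (future k) -> R)) => //.
    by apply: measurable_X_future; rewrite ltnNge -ltnS ik.
  by case: (i == k); [exact: measurable_snd|exact: measurable_cst].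
pose f z : \bar R := (A (\row_i phi i z))%:E.
have cell i w t : phi i (w, t) = if (i < k)%N then x ord0 i else if i == k then t else X i w.
  rewrite /phi [(i < k.+1)%N](_ : _ = (i == k) || (i < k)%N); last by rewrite ltnS leq_eqVlt.
  by case: (eqVneq i k) => [->|ik]//=; rewrite ltnn.
transitivity (\int[P]_w f (U w, Xf k w))%E.
  apply: eq_integral => w _; rewrite /f; congr (A _)%:E.
  by apply/rowP => i; rewrite !mxE cell; case: ifP => // _; case: eqVneq => [->|].
transitivity (\int[distribution P (Xf k)]_t \int[P]_w f (U w, t))%E; last first.
  apply: eq_integral => t _; apply: eq_integral => w _; rewrite /f; congr (A _)%:E.
  apply/rowP => i; rewrite !mxE /phi.
  by case: (i < k.+1)%N.
apply: integral_indep_pair.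
- move=> C D mC mD.
  apply: (@indep_g_sigma _ _ _ P (future k)) => //.
  + by rewrite -[X in measurable X]setTI; exact: mX.
  + by move=> C' GC'; exact: future_indep.
- by apply/measurable_EFinP; exact: mA.
- by move=> z; rewrite lee_fin.
Qed.

Let measurable_avg_upd A (k : 'I_n) x : coord_measurable A -> (forall z, 0 <= A z) ->
  measurable_fun setT (fun t : R => avg A k.+1 (upd k x t)).
Proof.
move=> mA A0.
pose phi (i : 'I_n) (z : T * R) : R :=
  if (i < k.+1)%N then (if i == k then z.2 else x ord0 i) else X i z.1.
have mphi i : measurable_fun setT (phi i).
  rewrite /phi; case: (i < k.+1)%N; last exact: (measurableT_comp (mX i)).
  by case: (i == k); [exact: measurable_snd|exact: measurable_cst].
pose f z : \bar R := (A (\row_i phi i z))%:E.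
have mf : measurable_fun setT f by apply/measurable_EFinP; exact: mA.
have f0 z : (0 <= f z)%E by rewrite lee_fin.
rewrite (_ : (fun t => _) = fubini_G P f); first exact: measurable_fun_fubini_tonelli_G.
apply/funext => t; apply: eq_integral => w _; congr (A _)%:E.
by apply/rowP => i; rewrite !mxE /phi; case: (i < k.+1)%N.
Qed.

(* Keeping two functions [A] and [B], instead of [exp (Q f)] and [exp (- f)] for an
   infimal convolution [Q f], makes the induction on the coordinates immediate and
   avoids the measurability of [Q f]. *)
Lemma expectation_mul_le A B (c : R) : coord_measurable A -> coord_measurable B ->
  (forall z, 0 <= A z) -> (forall z, 0 <= B z) -> 0 < c ->
  (forall x y, A x * B y <= c * \prod_(i < n) quarter_cosh (x ord0 i - y ord0 i) ^+ 2) ->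
  ((\int[P]_w (A (\row_i X i w))%:E) * (\int[P]_w (B (\row_i X i w))%:E) <= c%:E)%E.
Proof.
move=> mA mB A0 B0 c0 AB.
have avg_ge0 D k x : (forall z, 0 <= D z) -> (0 <= avg D k x)%E.
  by move=> D0; apply: integral_ge0 => w _; rewrite lee_fin.
(* Induction on the number [m] of integrated coordinates. Each step absorbs the factor of one
   coordinate by the one-dimensional inequality, applied with [c] times the product of the factors
   still frozen as its constant. *)
have main m : (m <= n)%N -> forall x y, (avg A (n - m) x * avg B (n - m) y <=
    (c * \prod_(i < n | (i < n - m)%N) quarter_cosh (x ord0 i - y ord0 i) ^+ 2)%:E)%E.
  elim: m => [_ x y|m IH mn x y].
    have full D z : avg D (n - 0) z = (D z)%:E.
      rewrite /avg subn0; under eq_integral.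
        move=> w _; rewrite (_ : mix n z w = z); last by apply/rowP => i; rewrite mxE ltn_ord.
        over.
      by rewrite integral_cst//= probability_setT mule1.
    rewrite !full -EFinM lee_fin; apply: (le_trans (AB x y)).
    rewrite ler_pM2l// subn0 [X in _ <= X](eq_bigl xpredT)// => i; exact: ltn_ord.
  have kn : (n - m.+1 < n)%N by lia.
  pose k := Ordinal kn.
  have kS : (n - m)%N = k.+1 by rewrite /=; lia.
  rewrite -[(n - m.+1)%N]/(k : nat) (avg_step _ _ mA A0) (avg_step _ _ mB B0).
  have prod0 : 0 < \prod_(i < n | (i < k)%N) quarter_cosh (x ord0 i - y ord0 i) ^+ 2.
    by apply: prodr_gt0 => i _; rewrite exprn_gt0// quarter_cosh_gt0.
  apply: (@laplace_integral_mul R (distribution P (Xf k)) (fun t => avg A k.+1 (upd k x t)) (fun t => avg B k.+1 (upd k y t))).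
  - move=> V mV; have [lap _] := lapX; exact: (lap k).2.
  - exact: measurable_avg_upd.
  - exact: measurable_avg_upd.
  - by move=> t; exact: avg_ge0.
  - by move=> t; exact: avg_ge0.
  - exact: mulr_gt0.
  move=> s t; have := IH (ltnW mn) (upd k x s) (upd k y t).
  rewrite kS => h; apply: (le_trans h); rewrite lee_fin.
  rewrite (bigD1 k) ?ltnSn//= !mxE eqxx -mulrA [_ ^+ 2 * _]mulrC.
  rewrite (eq_bigl (fun i : 'I_n => (i < k)%N)).
    rewrite (eq_bigr (fun i => quarter_cosh (x ord0 i - y ord0 i) ^+ 2))// => i ik.
    by rewrite !mxE (_ : i == k = false)//; apply/negbTE/eqP => ik'; move: ik; rewrite ik' ltnn.
  by move=> i; rewrite -val_eqE /=; apply/idP/idP; lia.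
have := main n (leqnn n) 0 0.
rewrite subnn big_pred0// mulr1.
suff E D : avg D 0 0 = (\int[P]_w (D (\row_i X i w))%:E)%E by rewrite !E.
by apply: eq_integral => w _; congr (D _)%:E; apply/rowP => i; rewrite !mxE.
Qed.

End tensorization.

(** * Elementary inequalities for the exponential *)

Section exp_bounds.
Context (R : realType).
Implicit Types x y v : R.

(** From [exp (- 1 / 6) >= 5 / 6] one gets [e <= (6 / 5) ^ 6 < 3]. *)
Lemma expR1_le3 : expR 1 <= 3 :> R.
Proof.
have h : expR (- 6^-1) ^+ 6 = (expR 1)^-1 :> R.
  by rewrite -expRM_natl -expRN; congr expR; lra.
have : 5 / 6 <= expR (- 6^-1) :> R by have := expR_ge1Dx (- 6^-1 : R); lra.
rewrite -(@ler_pXn2r _ 6) ?nnegrE ?expR_ge0 ?divr_ge0//.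
rewrite h => h2; rewrite -lef_pV2 ?posrE ?expR_gt0//.
by apply: le_trans h2; lra.
Qed.

(** The bounds [expR x * (1 - x) <= 1] and [expR x * (2 - x) <= 3] are combined with weights [1 - x]
    and [x], because [(1 - x) ^ 2 + x * (2 - x) = 1]. *)
Lemma expR_le_chord x : 0 <= x <= 1 -> expR x <= 1 + 2 * x.
Proof.
move=> /andP[x0 x1].
have e0 := expR_gt0 x.
have h1 : expR x * (1 - x) <= 1.
  rewrite -[leRHS](expRxMexpNx_1 x); apply: ler_wpM2l; first exact: ltW.
  by have := expR_ge1Dx (- x); lra.
have h2 : expR x * (2 - x) <= 3.
  apply: le_trans expR1_le3; rewrite [leRHS](_ : _ = expR x * expR (1 - x)).
    by rewrite ler_wpM2l ?(ltW e0)//; have := expR_ge1Dx (1 - x); lra.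
  by rewrite -expRD; congr expR; lra.
have : (1 - x) * (expR x * (1 - x)) <= 1 - x by rewrite -[leRHS]mulr1 ler_wpM2l//; lra.
have : x * (expR x * (2 - x)) <= x * 3 by rewrite ler_wpM2l.
lra.
Qed.

(** The derivative of the difference, [2 * cosh t - 2], is a square. *)
Lemma expR_sub_expRN x : 0 <= x -> 2 * x <= expR x - expR (- x).
Proof.
move=> x0; pose f (t : R) := expR t - expR (- t) - 2 * t.
have df (t : R) : is_derive t 1 f (expR t + expR (- t) - 2).
  rewrite /f; apply: is_derive_eq; rewrite /GRing.scale/=; ring.
have cf : {within `[0, x], continuous f}.
  by apply: continuous_subspaceT => t; apply: differentiable_continuous; apply/derivable1_diffP.
have [c _] := MVT_segment x0 (fun t _ => df t) cf.
have -> : f 0 = 0 by rewrite /f oppr0 mulr0 !subr0 subrr.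
rewrite /f subr0 => h; rewrite -subr_ge0 h mulr_ge0 ?subr0//.
have -> : expR c + expR (- c) - 2 = (expR (2^-1 * c) - expR (- (2^-1 * c))) ^+ 2.
  rewrite sqrrB -!expRM_natl -expRD mulrN mulrA mulfV// mul1r subrr expR0; lra.
exact: sqr_ge0.
Qed.

(** The right-hand side is the square of [2 * sinh (x / 2)]. Besides its use for [expR_le_cosh],
    this controls second moments by exponential ones. *)
Lemma sqr_le_cosh x : x ^+ 2 <= expR x + expR (- x) - 2.
Proof.
suff pos y : 0 <= y -> y ^+ 2 <= expR y + expR (- y) - 2.
  have [/pos//|/ltW x0] := leP 0 x.
  by have := pos (- x); rewrite sqrrN opprK oppr_ge0 [expR (- x) + _]addrC; apply.
move=> y0.
have -> : expR y + expR (- y) - 2 = (expR (2^-1 * y) - expR (- (2^-1 * y))) ^+ 2.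
  rewrite sqrrB -!expRM_natl -expRD mulrN mulrA mulfV// mul1r subrr expR0; lra.
have := @expR_sub_expRN (2^-1 * y); rewrite mulrA mulfV// mul1r => h.
by rewrite ler_pXn2r ?nnegrE ?h ?mulr_ge0// (le_trans y0)// h// mulr_ge0.
Qed.

(** Up to [v = 2] even the maximum [v ^ 2 / 4] of the exponent over [a] is affordable, its
    exponential being at most [1 + v ^ 2 / 2]. Beyond, [a <= 1] bounds the exponent by [v - 1], and
    [e >= 2]. *)
Lemma expR_le_cosh (v a : R) : 0 <= v -> 0 <= a <= 1 ->
  expR (a * v - a ^+ 2) <= (expR v + expR (- v)) / 2.
Proof.
move=> v0 /andP[a0 a1]; have [v2|v2] := leP v 2.
  apply: (@le_trans _ _ (expR (4^-1 * v ^+ 2))).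
    by rewrite ler_expR; have := sqr_ge0 (2^-1 * v - a); lra.
  apply: (le_trans (expR_le_chord _)); last by have := sqr_le_cosh v; lra.
  by rewrite mulr_ge0 ?sqr_ge0//=; nra.
apply: (@le_trans _ _ (expR v / 2)); last by rewrite ler_pM2r// lerDl expR_ge0.
apply: (@le_trans _ _ (expR (v - 1))); first by rewrite ler_expR; nra.
rewrite expRD ler_pM2l ?expR_gt0// expRN lef_pV2 ?posrE ?expR_gt0//.
by have := expR_ge1Dx (1 : R); lra.
Qed.

(** The previous bound at [2 * a] and [|u| / 4], squared: this is the origin of the constant 8 and
    of the restriction [a <= 1 / 2]. *)
Lemma expR_le_quarter_cosh (u a : R) : 0 <= a <= 2^-1 ->
  expR (a * `|u| - 8 * a ^+ 2) <= quarter_cosh u ^+ 2.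
Proof.
move=> a01.
have -> : a * `|u| - 8 * a ^+ 2 = 2%:R * ((2 * a) * (4^-1 * `|u|) - (2 * a) ^+ 2) by lra.
rewrite expRM_natl ler_pXn2r ?nnegrE ?expR_ge0 ?(ltW (quarter_cosh_gt0 _))//.
apply: le_trans (expR_le_cosh _ _) _; first by rewrite mulr_ge0.
  by lra.
rewrite /quarter_cosh; have [u0|u0] := leP 0 u; first by rewrite ger0_norm.
by rewrite ltr0_norm// mulrN opprK [X in X / 2]addrC.
Qed.

End exp_bounds.

(** * The Euclidean norm on row vectors *)

Section euclid_norm.
Context (R : realType) (n : nat).
Implicit Types u v : 'rV[R]_n.

Lemma euclid_norm_ge0 u : 0 <= euclid_norm u.
Proof. exact: sqrtr_ge0. Qed.

Lemma sqr_euclid_norm u : euclid_norm u ^+ 2 = \sum_(i < n) u ord0 i ^+ 2.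
Proof. by rewrite sqr_sqrtr// sumr_ge0// => i _; exact: sqr_ge0. Qed.

Lemma ler_norm_euclid u i : `|u ord0 i| <= euclid_norm u.
Proof.
rewrite -(@ler_pXn2r _ 2) ?nnegrE ?euclid_norm_ge0// sqr_euclid_norm.
rewrite real_normK ?num_real// (bigD1 i)//= lerDl.
by apply: sumr_ge0 => j _; exact: sqr_ge0.
Qed.

Lemma cauchy_schwarz_euclid u v :
  \sum_(i < n) u ord0 i * v ord0 i <= euclid_norm u * euclid_norm v.
Proof.
have [u0|u0] := eqVneq (euclid_norm u) 0.
  rewrite big1 ?mulr_ge0 ?euclid_norm_ge0// => i _.
  by have := ler_norm_euclid u i; rewrite u0 normr_le0 => /eqP ->; rewrite mul0r.
have [v0|v0] := eqVneq (euclid_norm v) 0.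
  rewrite big1 ?mulr_ge0 ?euclid_norm_ge0// => i _.
  by have := ler_norm_euclid v i; rewrite v0 normr_le0 => /eqP ->; rewrite mulr0.
have {}u0 : 0 < euclid_norm u by rewrite lt_neqAle eq_sym u0 euclid_norm_ge0.
have {}v0 : 0 < euclid_norm v by rewrite lt_neqAle eq_sym v0 euclid_norm_ge0.
set a := euclid_norm u in u0 *; set b := euclid_norm v in v0 *.
(* Young's inequality weighted by [b / a], so that each of the two halves sums to [a * b / 2]. *)
apply: (@le_trans _ _ (\sum_(i < n) (b / a * u ord0 i ^+ 2 + a / b * v ord0 i ^+ 2) / 2)).
  apply: ler_sum => i _; rewrite ler_pdivlMr//.
  move: (u ord0 i) (v ord0 i) => s t.
  rewrite -subr_ge0 (_ : _ - _ = (b * s - a * t) ^+ 2 / (a * b)).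
    by rewrite divr_ge0 ?sqr_ge0// ltW ?mulr_gt0.
  by field; rewrite !gt_eqF.
rewrite -mulr_suml big_split/= -!mulr_sumr -!sqr_euclid_norm -/a -/b.
by rewrite le_eqVlt; apply/orP; left; apply/eqP; field; rewrite !gt_eqF.
Qed.

Lemma euclid_normD u v : euclid_norm (u + v) <= euclid_norm u + euclid_norm v.
Proof.
rewrite -(@ler_pXn2r _ 2) ?nnegrE ?addr_ge0 ?euclid_norm_ge0//.
rewrite sqr_euclid_norm sqrrD !sqr_euclid_norm.
rewrite (eq_bigr (fun i => u ord0 i ^+ 2 + 2 * (u ord0 i * v ord0 i) + v ord0 i ^+ 2)); last first.
  by move=> i _; rewrite !mxE sqrrD mulr_natl.
rewrite !big_split/= lerD2r lerD2l -mulr_sumr -[leRHS]mulr_natl ler_pM2l//.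
exact: cauchy_schwarz_euclid.
Qed.

Lemma euclid_normN u : euclid_norm (- u) = euclid_norm u.
Proof. by congr Num.sqrt; apply: eq_bigr => i _; rewrite mxE sqrrN. Qed.

Lemma euclid_norm_le_l1 u : euclid_norm u <= l1_norm u.
Proof.
rewrite -(@ler_pXn2r _ 2) ?nnegrE ?euclid_norm_ge0//; last by apply: sumr_ge0.
rewrite sqr_euclid_norm [leRHS]expr2 {1}/l1_norm mulr_suml.
apply: ler_sum => i _; rewrite -real_normK ?num_real// expr2 ler_wpM2l//.
by rewrite /l1_norm (bigD1 i)//= lerDl sumr_ge0.
Qed.

End euclid_norm.

(* Composed with a coordinatewise measurable map, [F] is the limit of its values
   at the points of finer and finer grids, which are countably many. *)
Lemma lipschitz_coord_measurable (R : realType) (n : nat) (F : 'rV[R]_n -> R) (c : R) :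
  (forall x y, `|F x - F y| <= c * l1_norm (x - y)) -> coord_measurable F.
Proof.
move=> Fc dU U phi mphi.
pose grid (m : nat) (z : 'rV[int]_n) : 'rV[R]_n := \row_i ((z ord0 i)%:~R / m.+1%:R).
pose q (m : nat) (w : U) : 'rV[int]_n := \row_i (Num.floor (m.+1%:R * phi i w)).
have m0 (m : nat) : 0 < m.+1%:R :> R by [].
apply: (@measurable_fun_cvg _ _ _ _ (fun m w => F (grid m (q m w)))).
  move=> m _ B mB; rewrite setTI.
  rewrite (_ : _ @^-1` B = \bigcup_(z in [set: 'rV[int]_n])
     (if `[< B (F (grid m z)) >] then [set w | q m w = z] else set0)); last first.
    apply/seteqP; split => w.
      by move=> Bw; exists (q m w) => //; case: asboolP.
    by move=> [z _]; case: asboolP => //= Bz qwz; rewrite qwz.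
  apply: countable_bigcupT_measurable => // z; case: asboolP => // _.
  rewrite (_ : mkset _ = \bigcap_(i in [set: 'I_n])
     ((phi i) @^-1` `[(z ord0 i)%:~R / m.+1%:R, (z ord0 i + 1)%:~R / m.+1%:R[)).
    apply: fin_bigcap_measurable => // i _.
    by rewrite -[X in measurable X]setTI; apply: mphi.
  have cell i w : (phi i w \in `[(z ord0 i)%:~R / m.+1%:R, (z ord0 i + 1)%:~R / m.+1%:R[) =
     (Num.floor (m.+1%:R * phi i w) == z ord0 i).
    rewrite in_itv/= real_floor_eq ?num_real// ler_pdivrMr// ltr_pdivlMr//.
    by rewrite ![phi i w * _]mulrC.
  apply/seteqP; split => w /=.
    by move=> qz i _; change (phi i w \in `[(z ord0 i)%:~R / m.+1%:R, (z ord0 i + 1)%:~R / m.+1%:R[); rewrite cell -qz mxE.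
  by move=> h; apply/rowP => i; rewrite mxE; apply/eqP; rewrite -cell; exact: (h i).
move=> w _; apply/cvgrPdist_le => e e0; near=> m.
have n0 : 0 <= l1_norm ((\row_i phi i w) - grid m (q m w)) <= n%:R / m.+1%:R.
  rewrite sumr_ge0//= /l1_norm mulr_natl -[n in X in _ <= X]card_ord -sumr_const.
  apply: ler_sum => i _; rewrite !mxE.
  have := real_floor_itv (num_real (m.+1%:R * phi i w)); rewrite intrD => /andP[h1 h2].
  move: h1 h2; set K := Num.floor _; move: K%:~R => k {K} h1 h2.
  move: (m.+1%:R : R) (m0 m) h1 h2 => M M0 h1 h2.
  have -> : phi i w - k / M = (M * phi i w - k) / M by field; rewrite gt_eqF.
  have M00 : 0 <= M^-1 by rewrite invr_ge0 ltW.
  rewrite normrM (ger0_norm M00) ler_piMl//.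
  by rewrite ger0_norm; lra.
apply: (le_trans (Fc _ _)).
have [c0|c0] := leP c 0.
  by rewrite (le_trans _ (ltW e0))// mulr_le0_ge0//; case/andP: n0.
apply: (@le_trans _ _ (c * (n%:R / m.+1%:R))); first by rewrite ler_pM2l//; case/andP: n0.
rewrite mulrA ler_pdivrMr// mulrC -ler_pdivrMl// ltW//.
apply: (@lt_le_trans _ _ m%:R); last by rewrite ler_nat.
by near: m; exact: nbhs_infty_gtr.
Unshelve. all: by end_near. Qed.

(** * Jensen's inequality and Chernoff bounds *)

Section exp_moments.
Context (dT : measure_display) (T : measurableType dT) (R : realType) (P : probability T R).
Implicit Types f g : T -> R.

Lemma integrable_bound f g : measurable_fun setT f ->
  P.-integrable setT (EFin \o g) -> (forall w, `|f w| <= g w) ->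
  P.-integrable setT (EFin \o f).
Proof.
move=> mf ig fg; apply: (le_integrable measurableT _ _ ig); first exact/measurable_EFinP.
by move=> w _ /=; rewrite lee_fin (le_trans (fg w))// ler_norm.
Qed.

Lemma integrable_ge0 f : measurable_fun setT f -> (forall w, 0 <= f w) ->
  (\int[P]_w (f w)%:E < +oo)%E -> P.-integrable setT (EFin \o f).
Proof.
move=> mf f0 fy; apply/integrableP; split; first exact/measurable_EFinP.
by under eq_integral do rewrite /= ger0_norm//.
Qed.

Lemma EFin_Rintegral f : P.-integrable setT (EFin \o f) ->
  (\int[P]_w (f w)%:E = (\int[P]_w f w)%:E)%E.
Proof. by move=> fi; rewrite /Rintegral fineK//; exact: integrable_fin_num. Qed.

Lemma Rintegral_cstT (r : R) : \int[P]_w r = r.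
Proof. by rewrite Rintegral_cst//= probability_setT mulr1. Qed.

Lemma integrable_cstT (r : R) : P.-integrable setT (EFin \o (fun=> r)).
Proof. exact: finite_measure_integrable_cst. Qed.

Lemma integrableDR f g : P.-integrable setT (EFin \o f) ->
  P.-integrable setT (EFin \o g) -> P.-integrable setT (EFin \o (fun w => f w + g w)).
Proof. by move=> fi gi; apply: integrableD fi gi. Qed.

Lemma integrableBR f g : P.-integrable setT (EFin \o f) ->
  P.-integrable setT (EFin \o g) -> P.-integrable setT (EFin \o (fun w => f w - g w)).
Proof. by move=> fi gi; apply: integrableB fi gi. Qed.

Lemma integrableZR (r : R) f : P.-integrable setT (EFin \o f) ->
  P.-integrable setT (EFin \o (fun w => r * f w)).
Proof. by move=> fi; apply: integrableZl fi. Qed.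

(** Jensen's inequality, by integrating [1 + t <= expR t]. Applied to [- F], it bounds the second
    factor of the product inequality from below, which leaves an upper bound on the first. *)
Lemma integral_expR_centered_ge1 f : P.-integrable setT (EFin \o f) ->
  (1 <= \int[P]_w (expR (f w - \int[P]_w f w))%:E)%E.
Proof.
move=> fi; set m := \int[P]_w f w.
have mf : measurable_fun setT f by apply/measurable_EFinP; case/integrableP: fi.
have me : measurable_fun setT (fun w => expR (f w - m)).
  by apply: measurableT_comp => //; exact: measurable_funB.
have [ey|ey] := ltP (\int[P]_w (expR (f w - m))%:E)%E +oo%E; last by rewrite (le_trans _ ey)// leey.
have ei : P.-integrable setT (EFin \o (fun w => expR (f w - m))).
  by apply: integrable_ge0 => // w; exact: expR_ge0.
have fmi : P.-integrable setT (EFin \o (fun w => f w - m)).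
  by apply: integrableBR => //; exact: integrable_cstT.
rewrite (EFin_Rintegral ei) lee_fin.
apply: (@le_trans _ _ (\int[P]_w (1 + (f w - m)))).
  rewrite RintegralD//; last exact: integrable_cstT.
  rewrite RintegralB//; last exact: integrable_cstT.
  by rewrite !Rintegral_cstT -/m subrr addr0.
apply: le_Rintegral => //; first by apply: integrableDR => //; exact: integrable_cstT.
by move=> w _; exact: expR_ge1Dx.
Qed.

Lemma chernoff_bound f (K t : R) : measurable_fun setT f ->
  (\int[P]_w (expR (f w))%:E <= K%:E)%E ->
  (P [set w | (t < f w)%R] <= (K * expR (- t))%:E)%E.
Proof.
move=> mf fK.
have mA : measurable [set w | t < f w].
  rewrite (_ : [set w | _] = f @^-1` `]t, +oo[); last first.
    by apply/seteqP; split => w /=; rewrite in_itv/= andbT.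
  by rewrite -[X in measurable X]setTI; exact: mf.
rewrite expRN EFinM lee_pdivlMr ?expR_gt0//; apply: le_trans fK.
rewrite -[X in P X]setIT -integral_indic// muleC -ge0_integralZl//; last first.
  by apply/measurable_EFinP; exact: measurable_indic.
apply: ge0_le_integral => //.
- by apply: emeasurable_funM => //; apply/measurable_EFinP; exact: measurable_indic.
- exact/measurable_EFinP/(measurableT_comp (@measurable_expR R) mf).
move=> w _; rewrite -EFinM lee_fin indicE; case: (boolP (w \in _)) => [|_] /=.
  by rewrite inE/= mulr1 ler_expR => /ltW.
by rewrite mulr0 expR_ge0.
Qed.

End exp_moments.

(** The extension is the infimum over [u] in [D] of [f u + |x - u|]: finite because it stays above
    [f u0 - |x - u0|], and Lipschitz as an infimum of Lipschitz functions. *)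
Lemma mcshane_extension (R : realType) (n : nat) (D : set 'rV[R]_n) (f : 'rV[R]_n -> R) :
  D !=set0 -> (forall u v, D u -> D v -> `|f u - f v| <= euclid_norm (u - v)) ->
  exists F : 'rV[R]_n -> R, (forall x y, `|F x - F y| <= euclid_norm (x - y)) /\
    (forall u, D u -> F u = f u).
Proof.
move=> [u0 Du0] fL.
pose E x := [set f u + euclid_norm (x - u) | u in D].
have E0 x : E x !=set0 by exists (f u0 + euclid_norm (x - u0)), u0.
have nC (x y : 'rV[R]_n) : euclid_norm (x - y) = euclid_norm (y - x).
  by rewrite -euclid_normN opprB.
have tri (x y z : 'rV[R]_n) : euclid_norm (x - z) <= euclid_norm (x - y) + euclid_norm (y - z).
  by rewrite (le_trans _ (euclid_normD _ _))// addrA subrK.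
have lbE x : has_lbound (E x).
  exists (f u0 - euclid_norm (x - u0)) => _ [u Du <-].
  have := fL _ _ Du0 Du; rewrite ler_norml => /andP[_ h].
  have := tri u0 x u; rewrite (nC u0 x); lra.
have FL x y : inf (E x) <= inf (E y) + euclid_norm (x - y).
  rewrite -lerBlDr; apply: lb_le_inf => // _ [u Du <-].
  have : inf (E x) <= f u + euclid_norm (x - u) by apply: ge_inf => //; exists u.
  have := tri x y u; lra.
exists (fun x => inf (E x)); split => [x y|u Du].
  rewrite ler_norml; have := FL x y; have := FL y x; rewrite (nC y x); lra.
apply/eqP; rewrite eq_le; apply/andP; split.
  apply: ge_inf => //; exists u => //; rewrite subrr /euclid_norm big1 ?sqrtr0 ?addr0// => i _.
  by rewrite mxE expr0n.
apply: lb_le_inf => // _ [v Dv <-].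
by have := fL _ _ Du Dv; rewrite ler_norml => /andP[_ h]; lra.
Qed.

(** * Moments and Lipschitz functions of a Laplace vector *)

Section laplace_vector.
Context (dT : measure_display) (T : measurableType dT) (R : realType)
  (P : probability T R) (n : nat) (X : 'I_n -> T -> R).
Hypothesis lapX : std_laplace_vector P X.
Implicit Types (F : 'rV[R]_n -> R) (x y : 'rV[R]_n).
Local Notation Xv w := (\row_i X i w).
Local Notation mu := (@lebesgue_measure R).

Let mX i : measurable_fun setT (X i). Proof. by case: lapX => /(_ i)[]. Qed.

(** Tilting by [exp (a |x|)] turns the Laplace density into a multiple of [two_sided_exp (1 - a)],
    whose mass is 2. *)
Lemma laplace_mgf i (a : R) : a < 1 ->
  (\int[P]_w (expR (a * `|X i w|))%:E = ((1 - a)^-1)%:E)%E.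
Proof.
move=> a1; pose Xf : {mfun T >-> measurableTypeR R} :=
  @mfun_Sub _ _ T (measurableTypeR R) (X i) (mem_set (mX i)).
have mE : measurable_fun setT (fun x : R => (expR (a * `|x|))%:E).
  apply/measurable_EFinP; apply: measurableT_comp => //.
  by apply: measurable_funM => //; exact: normr_measurable.
transitivity (\int[distribution P Xf]_x (expR (a * `|x|))%:E)%E.
  by rewrite ge0_integral_distribution// => x; rewrite lee_fin expR_ge0.
rewrite (@ge0_integral_density _ _ _ mu (@laplace_pdf R))//.
- transitivity (\int[mu]_x ((2 * (1 - a))^-1%:E * (two_sided_exp (1 - a) x)%:E))%E.
    apply: eq_integral => x _; rewrite -!EFinM; congr EFin.
    rewrite /laplace_pdf /two_sided_exp mulrA -expRD.
    rewrite (_ : a * `|x| - `|x| = - (1 - a) * `|x|); last by ring.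
    by field; rewrite subr_eq0 eq_sym lt_eqF.
  rewrite ge0_integralZl//.
  + rewrite integral_two_sided_exp ?subr_gt0// -EFinM; congr EFin.
    by field; rewrite subr_eq0 eq_sym lt_eqF.
  + by apply/measurable_EFinP; exact: measurable_two_sided_exp.
  + by move=> x _; rewrite lee_fin two_sided_exp_ge0// subr_ge0 ltW.
  + by rewrite lee_fin invr_ge0 mulr_ge0// subr_ge0 ltW.
- exact: measurable_laplace_pdf.
- exact: laplace_pdf_ge0.
- by move=> V mV; have [lap _] := lapX; exact: (lap i).2.
Qed.

Let mabs i : measurable_fun setT (fun w => `|X i w|).
Proof. by apply: (measurableT_comp (@normr_measurable R setT)). Qed.

Let mexp i (a : R) : measurable_fun setT (fun w => expR (a * `|X i w|)).
Proof. by apply: measurableT_comp => //; exact: measurable_funM. Qed.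

Let iexp i (a : R) : a < 1 -> P.-integrable setT (EFin \o (fun w => expR (a * `|X i w|))).
Proof.
move=> a1; apply: integrable_ge0 => //.
by rewrite laplace_mgf// ltry.
Qed.

Let Eexp i (a : R) : a < 1 -> \int[P]_w expR (a * `|X i w|) = (1 - a)^-1.
Proof. by move=> a1; rewrite /Rintegral laplace_mgf. Qed.

Lemma integrable_laplace_norm i : P.-integrable setT (EFin \o (fun w => `|X i w|)).
Proof.
apply: (integrable_bound (g := fun w => 2 * expR (2^-1 * `|X i w|))) => //.
  by apply: integrableZR; apply: iexp; rewrite invf_lt1// ltr1n.
by move=> w; rewrite normr_id; have := expR_ge1Dx (2^-1 * `|X i w|); lra.
Qed.

(** From [|x| >= 9 (1 - exp (- |x| / 9))], whose mean is [9 (1 - 9 / 10)]. *)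
Lemma laplace_mean_norm_ge i : 9 / 10 <= \int[P]_w `|X i w|.
Proof.
have h : - (9^-1) < 1 :> R by lra.
apply: (@le_trans _ _ (\int[P]_w (9 * (1 - expR (- 9^-1 * `|X i w|))))).
  rewrite RintegralZl//; last by apply: integrableBR; [exact: integrable_cstT|exact: iexp].
  rewrite RintegralB//; [|exact: integrable_cstT|exact: iexp].
  rewrite Rintegral_cstT Eexp// (_ : (1 - - 9^-1)^-1 = 9 / 10); last by field.
  by lra.
apply: le_Rintegral => //.
- by apply: integrableZR; apply: integrableBR; [exact: integrable_cstT|exact: iexp].
- exact: integrable_laplace_norm.
- by move=> w _; have := expR_ge1Dx (- 9^-1 * `|X i w|); lra.
Qed.

Let sqr_bound i w : X i w ^+ 2 <=
  4 * (expR (2^-1 * `|X i w|) + expR (- 2^-1 * `|X i w|) - 2).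
Proof.
have := sqr_le_cosh (2^-1 * `|X i w|).
by rewrite exprMn real_normK ?num_real// mulNr; lra.
Qed.

Let isqr_bound i : P.-integrable setT (EFin \o
  (fun w => 4 * (expR (2^-1 * `|X i w|) + expR (- 2^-1 * `|X i w|) - 2))).
Proof.
apply: integrableZR; apply: integrableBR; last exact: integrable_cstT.
by apply: integrableDR; apply: iexp; lra.
Qed.

Lemma integrable_laplace_sqr i : P.-integrable setT (EFin \o (fun w => X i w ^+ 2)).
Proof.
apply: (integrable_bound _ (isqr_bound i)); first exact: measurable_funX.
by move=> w; rewrite ger0_norm ?sqr_ge0.
Qed.

(** The bound [x ^ 2 <= 4 (2 cosh (x / 2) - 2)] has mean [4 (2 + 2 / 3 - 2)]. *)
Lemma laplace_sqr_mean_le i : \int[P]_w X i w ^+ 2 <= 8 / 3.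
Proof.
have h1 : 2^-1 < 1 :> R by lra.
have h2 : - 2^-1 < 1 :> R by lra.
apply: le_trans (le_Rintegral _ (integrable_laplace_sqr i) (isqr_bound i) _) _ => //.
rewrite RintegralZl//; last first.
  apply: integrableBR; last exact: integrable_cstT.
  by apply: integrableDR; exact: iexp.
rewrite RintegralB//; [|by apply: integrableDR; exact: iexp|exact: integrable_cstT].
rewrite RintegralD//; [|exact: iexp|exact: iexp].
rewrite Rintegral_cstT !Eexp// (_ : (1 - 2^-1)^-1 = 2); last by field.
rewrite (_ : (1 - - 2^-1)^-1 = 2 / 3); last by field.
by lra.
Qed.

Lemma integral_sum_coord (g : 'I_n -> T -> R) :
  (forall i, P.-integrable setT (EFin \o g i)) ->
  P.-integrable setT (EFin \o (fun w => \sum_i g i w)) /\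
  \int[P]_w (\sum_i g i w) = \sum_i \int[P]_w g i w.
Proof.
move=> gi; have ii : P.-integrable setT (fun w => \sum_i (g i w)%:E)%E.
  by apply: (integrable_sum measurableT) => i _; exact: gi.
split.
  apply: (@eq_integrable _ _ _ P setT measurableT _ _ _ ii) => w _.
  by rewrite /= sumEFin.
rewrite /Rintegral; under eq_integral do rewrite -sumEFin.
rewrite integral_sum//.
rewrite (eq_bigr (fun i => (\int[P]_w g i w)%:E))//; first by rewrite sumEFin.
by move=> i _; rewrite EFin_Rintegral.
Qed.

Lemma integrable_lipschitz F (c : R) : (forall x y, `|F x - F y| <= c * l1_norm (x - y)) ->
  P.-integrable setT (EFin \o (fun w => F (Xv w))).
Proof.
move=> Fc; have mF := lipschitz_coord_measurable Fc.
apply: (integrable_bound (g := fun w => `|F 0| + c * \sum_i `|X i w|)).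
- exact: mF.
- apply: integrableDR; first exact: integrable_cstT.
  apply: integrableZR; apply: (integral_sum_coord _).1 => i; exact: integrable_laplace_norm.
move=> w; have := Fc (Xv w) 0; rewrite subr0 /l1_norm.
under eq_bigr do rewrite mxE.
by move=> h; have := ler_normD (F (Xv w) - F 0) (F 0); rewrite subrK; lra.
Qed.

(** The product inequality for [exp (F - m)] and [exp (m - F)], where the second integral is at
    least 1 by Jensen. *)
Lemma expR_centered_le F (K : R) : coord_measurable F ->
  P.-integrable setT (EFin \o (fun w => F (Xv w))) ->
  (forall x y, expR (F x - F y) <= expR K * \prod_i quarter_cosh (x ord0 i - y ord0 i) ^+ 2) ->
  (\int[P]_w (expR (F (Xv w) - \int[P]_w F (Xv w)))%:E <= (expR K)%:E)%E.
Proof.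
move=> mF iF FK; set m := \int[P]_w F (Xv w).
have iN : P.-integrable setT (EFin \o (fun w => -1 * F (Xv w))) by exact: integrableZR.
have := integral_expR_centered_ge1 iN; rewrite RintegralZl// -/m => b1.
have := @expectation_mul_le _ _ _ _ _ _ lapX (fun x => expR (F x - m)) (fun x => expR (-1 * F x - -1 * m)) (expR K).
have mA : coord_measurable (fun x => expR (F x - m)).
  move=> dU U phi mphi; apply: measurableT_comp => //; apply: measurable_funB => //; exact: mF.
have mB : coord_measurable (fun x => expR (-1 * F x - -1 * m)).
  move=> dU U phi mphi; apply: measurableT_comp => //; apply: measurable_funB => //.
  apply: measurable_funM => //; exact: mF.
move=> /(_ mA mB (fun=> expR_ge0 _) (fun=> expR_ge0 _) (expR_gt0 _)) H.
apply: le_trans (H _); last first.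
  by move=> x y; rewrite -expRD (_ : _ + _ = F x - F y)//; lra.
rewrite -[leLHS]mule1 lee_wpmul2l//.
by apply: integral_ge0 => w _; rewrite lee_fin expR_ge0.
Qed.

(** Every coordinate uses the same slope [a] in [expR_le_quarter_cosh], at the cost [8 * a ^ 2]
    each. *)
Lemma expR_centered_le_l1 F (a : R) : 0 <= a <= 2^-1 ->
  (forall x y, `|F x - F y| <= a * l1_norm (x - y)) ->
  (\int[P]_w (expR (F (Xv w) - \int[P]_w F (Xv w)))%:E <= (expR (8 * n%:R * a ^+ 2))%:E)%E.
Proof.
move=> a01 Fa; apply: expR_centered_le.
- exact: lipschitz_coord_measurable Fa.
- exact: integrable_lipschitz Fa.
move=> x y; apply: (@le_trans _ _ (expR (8 * n%:R * a ^+ 2 +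
    \sum_i (a * `|x ord0 i - y ord0 i| - 8 * a ^+ 2)))).
  rewrite ler_expR (le_trans (ler_norm _))// (le_trans (Fa x y))//.
  rewrite sumrB -mulr_sumr sumr_const card_ord -[_ *+ n]mulr_natl.
  rewrite /l1_norm (eq_bigr (fun i => `|x ord0 i - y ord0 i|)); last by move=> i _; rewrite !mxE.
  by lra.
rewrite expRD ler_pM2l ?expR_gt0// expR_sum; apply: ler_prod => i _.
by rewrite expR_ge0 expR_le_quarter_cosh.
Qed.

Lemma expR_centered_le_euclid F (a : R) : 0 <= a <= 2^-1 ->
  (forall x y, `|F x - F y| <= a * euclid_norm (x - y)) ->
  (\int[P]_w (expR (F (Xv w) - \int[P]_w F (Xv w)))%:E <= (expR (8 * a ^+ 2))%:E)%E.
Proof.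
move=> /andP[a0 a1] Fa.
have Fl1 x y : `|F x - F y| <= a * l1_norm (x - y).
  by rewrite (le_trans (Fa x y))// ler_wpM2l// euclid_norm_le_l1.
apply: expR_centered_le.
- exact: lipschitz_coord_measurable Fl1.
- exact: integrable_lipschitz Fl1.
(* Coordinate [i] gets the slope [a * b i]: the linear terms add up to [a] times the Euclidean norm
   of [u], the costs only to [8 * a ^ 2]. The slopes may depend on [x] and [y] since the hypothesis
   to check is pointwise. If [u = 0] then [b = 0], hence only an inequality in [sum2]. *)
move=> x y; set u := x - y; pose b i := `|u ord0 i| / euclid_norm u.
have b01 i : 0 <= b i <= 1.
  have [u0|u0] := eqVneq (euclid_norm u) 0; first by rewrite /b u0 invr0 mulr0 lexx ler01.
  have {}u0 : 0 < euclid_norm u by rewrite lt_neqAle eq_sym u0 euclid_norm_ge0.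
  by rewrite divr_ge0 ?euclid_norm_ge0//= ler_pdivrMr// mul1r ler_norm_euclid.
have sum1 : \sum_i b i * `|u ord0 i| = euclid_norm u.
  rewrite (eq_bigr (fun i => u ord0 i ^+ 2 / euclid_norm u)); last first.
    by move=> i _; rewrite /b mulrAC -expr2 real_normK ?num_real.
  rewrite -mulr_suml -sqr_euclid_norm expr2.
  have [->|u0] := eqVneq (euclid_norm u) 0; first by rewrite !mul0r.
  by rewrite mulfK.
have sum2 : \sum_i b i ^+ 2 <= 1.
  rewrite (eq_bigr (fun i => u ord0 i ^+ 2 / euclid_norm u ^+ 2)); last first.
    by move=> i _; rewrite /b exprMn exprVn real_normK ?num_real.
  rewrite -mulr_suml -sqr_euclid_norm.
  have [->|u0] := eqVneq (euclid_norm u) 0; first by rewrite expr0n mul0r.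
  by rewrite divff// expf_neq0.
apply: (@le_trans _ _ (expR (8 * a ^+ 2 +
    \sum_i ((a * b i) * `|x ord0 i - y ord0 i| - 8 * (a * b i) ^+ 2)))).
  rewrite ler_expR (le_trans (ler_norm _))// (le_trans (Fa x y))// -/u.
  rewrite sumrB (eq_bigr (fun i => a * (b i * `|u ord0 i|))); last first.
    by move=> i _; rewrite -mulrA; congr (_ * (_ * `|_|)); rewrite /u !mxE.
  rewrite -mulr_sumr sum1 (eq_bigr (fun i => 8 * a ^+ 2 * b i ^+ 2)); last first.
    by move=> i _; rewrite exprMn mulrA.
  rewrite -mulr_sumr; have : 8 * a ^+ 2 * (\sum_i b i ^+ 2) <= 8 * a ^+ 2 * 1.
    by rewrite ler_wpM2l// mulr_ge0 ?sqr_ge0.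
  by lra.
rewrite expRD ler_pM2l ?expR_gt0// expR_sum; apply: ler_prod => i _.
rewrite expR_ge0 expR_le_quarter_cosh//; have /andP[bi0 bi1] := b01 i.
by rewrite mulr_ge0//= (le_trans _ a1)// ler_piMr.
Qed.

End laplace_vector.

(** * Concentration of the l1 and Euclidean norms *)

Lemma euclid_normZ (R : realType) (n : nat) (c : R) (u : 'rV[R]_n) :
  euclid_norm (c *: u) = `|c| * euclid_norm u.
Proof.
rewrite -(sqrtr_sqr c) -sqrtrM ?sqr_ge0//; congr Num.sqrt.
by rewrite mulr_sumr; apply: eq_bigr => i _; rewrite mxE exprMn.
Qed.

Section tails.
Context (dT : measure_display) (T : measurableType dT) (R : realType) (P : probability T R).
Implicit Types f g h : T -> R.

Lemma measurable_gt f (t : R) : measurable_fun setT f -> measurable [set w | t < f w].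
Proof.
move=> mf; rewrite (_ : [set w | _] = f @^-1` `]t, +oo[); last first.
  by apply/seteqP; split => w /=; rewrite in_itv/= andbT.
by rewrite -[X in measurable X]setTI; exact: mf.
Qed.

Lemma probability_sub_union (A B C : set T) (p q : R) :
  measurable A -> measurable B -> measurable C -> A `<=` B `|` C ->
  (P B <= p%:E)%E -> (P C <= q%:E)%E -> (P A <= (p + q)%:E)%E.
Proof.
move=> mA mB mC ABC pB qC.
apply: (@le_trans _ _ (P (B `|` C))).
  by apply: le_measure => //; rewrite inE//; exact: measurableU.
by rewrite (le_trans (measureU2 _ mB mC))// EFinD leeD.
Qed.

End tails.

Section laplace_vector.
Context (dT : measure_display) (T : measurableType dT) (R : realType)
  (P : probability T R) (n : nat) (X : 'I_n -> T -> R).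
Hypotheses (lapX : std_laplace_vector P X) (n_gt0 : (0 < n)%N).
Local Notation Xv w := (\row_i X i w).
Implicit Types F : 'rV[R]_n -> R.

Let S (w : T) : R := l1_norm (Xv w).
Let N (w : T) : R := euclid_norm (Xv w).
Let M : R := \int[P]_w S w.
Let nR : 0 < n%:R :> R. Proof. by rewrite ltr0n. Qed.

Let SE w : S w = \sum_(i < n) `|X i w|.
Proof. by apply: eq_bigr => i _; rewrite mxE. Qed.

Let S_ge0 w : 0 <= S w. Proof. exact: sumr_ge0. Qed.

Let l1_lip (a : R) (x y : 'rV[R]_n) : `|a * l1_norm x - a * l1_norm y| <= `|a| * l1_norm (x - y).
Proof.
rewrite -mulrBr normrM ler_wpM2l// /l1_norm -sumrB (le_trans (ler_norm_sum _ _ _))//.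
by apply: ler_sum => i _; rewrite !mxE ler_dist_dist.
Qed.

Let euclid_lip (a : R) (x y : 'rV[R]_n) :
  `|a * euclid_norm x - a * euclid_norm y| <= `|a| * euclid_norm (x - y).
Proof.
rewrite -mulrBr normrM ler_wpM2l// ler_norml.
have := euclid_normD (x - y) y; rewrite subrK.
have := euclid_normD (y - x) x; rewrite subrK -[euclid_norm (y - x)]euclid_normN opprB.
lra.
Qed.

Let iS : P.-integrable setT (EFin \o S).
Proof.
apply: (integrable_lipschitz lapX (F := @l1_norm R n) (c := 1)) => x y.
by have := l1_lip 1 x y; rewrite !mul1r normr1 mul1r.
Qed.

Let mS : measurable_fun setT S.
Proof. by apply/measurable_EFinP; case/integrableP: iS. Qed.

Let iN : P.-integrable setT (EFin \o N).
Proof.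
apply: (integrable_lipschitz lapX (F := @euclid_norm R n) (c := 1)) => x y.
have := euclid_lip 1 x y; rewrite !mul1r normr1 mul1r => /le_trans; apply.
exact: euclid_norm_le_l1.
Qed.

Let mN : measurable_fun setT N.
Proof. by apply/measurable_EFinP; case/integrableP: iN. Qed.

Let M_ge : 9 / 10 * n%:R <= M.
Proof.
rewrite /M; under eq_Rintegral do rewrite SE.
rewrite (integral_sum_coord _).2; last by move=> i; exact: (integrable_laplace_norm lapX).
rewrite (_ : 9 / 10 * n%:R = \sum_(i < n) 9 / 10); last first.
  by rewrite sumr_const card_ord mulr_natr.
by apply: ler_sum => i _; exact: (laplace_mean_norm_ge lapX).
Qed.

Let M_gt0 : 0 < M. Proof. by apply: lt_le_trans M_ge; rewrite mulr_gt0. Qed.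

Let iN2 : P.-integrable setT (EFin \o (fun w => N w ^+ 2)) /\ \int[P]_w N w ^+ 2 <= 8 / 3 * n%:R.
Proof.
have NE w : N w ^+ 2 = \sum_(i < n) X i w ^+ 2.
  by rewrite sqr_euclid_norm; apply: eq_bigr => i _; rewrite mxE.
have [i1 i2] := integral_sum_coord (integrable_laplace_sqr lapX).
have -> : (fun w => N w ^+ 2) = (fun w => \sum_(i < n) X i w ^+ 2) by apply/funext.
split => //; rewrite i2 (_ : 8 / 3 * n%:R = \sum_(i < n) 8 / 3); last first.
  by rewrite sumr_const card_ord mulr_natr.
by apply: ler_sum => i _; exact: (laplace_sqr_mean_le lapX).
Qed.

Let S_exp (a : R) : `|a| <= 2^-1 ->
  (\int[P]_w (expR (a * (S w - M)))%:E <= (expR (8 * n%:R * a ^+ 2))%:E)%E.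
Proof.
move=> a1; have := @expR_centered_le_l1 _ _ _ _ _ _ lapX (fun x => a * l1_norm x) `|a|.
rewrite normr_ge0 a1 real_normK ?num_real// => /(_ isT (l1_lip a)).
rewrite RintegralZl//; under eq_integral do rewrite -mulrBr.
by [].
Qed.

(** The choice [a = b / (16 * n)] minimizes [8 * n * a ^ 2 - a * b], and [b <= 8 * n] is the
    constraint [a <= 1 / 2]. *)
Let S_tail (b : R) : 0 < b <= 8 * n%:R ->
  (P [set w | (b < `|S w - M|)%R] <= (2 * expR (- (b ^+ 2 / (32 * n%:R))))%:E)%E.
Proof.
move=> /andP[b0 b8]; pose a := b / (16 * n%:R).
have a0 : 0 < a by rewrite divr_gt0// mulr_gt0.
have a1 : `|a| <= 2^-1 by rewrite gtr0_norm// ler_pdivrMr ?mulr_gt0//; lra.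
have E : expR (8 * n%:R * a ^+ 2) * expR (- (a * b)) = expR (- (b ^+ 2 / (32 * n%:R))).
  by rewrite -expRD; congr expR; rewrite /a; field; rewrite gt_eqF.
have mSM (c : R) : measurable_fun setT (fun w => c * (S w - M)).
  by apply: measurable_funM => //; exact: measurable_funB.
rewrite mulr_natl mulr2n -{1}E -E.
apply: (@probability_sub_union _ _ _ _ _ [set w | a * b < a * (S w - M)] [set w | a * b < - a * (S w - M)]).
- by apply: measurable_gt; apply: measurableT_comp => //; exact: measurable_funB.
- exact: measurable_gt.
- exact: measurable_gt.
- move=> w /=; rewrite mulNr -mulrN !ltr_pM2l//.
  by case: (lerP 0 (S w - M)) => [/ger0_norm ->|/ltr0_norm ->]; [left|right].
- apply: chernoff_bound => //; exact: S_exp.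
- apply: chernoff_bound => //; rewrite -[a ^+ 2]sqrrN; apply: S_exp.
  by rewrite normrN.
Qed.

(** At [a ^ 2 = 1 / (8 * n)] both exponential moments are at most [e <= 3], so [sqr_le_cosh] yields
    [8 * n * (3 + 3 - 2)]. *)
Let iSM : P.-integrable setT (EFin \o (fun w => (S w - M) ^+ 2)) /\
  \int[P]_w (S w - M) ^+ 2 <= 32 * n%:R.
Proof.
pose a : R := Num.sqrt ((8 * n%:R)^-1).
have n1 : 1 <= n%:R :> R by rewrite ler1n.
have aa : a ^+ 2 = (8 * n%:R)^-1 by rewrite sqr_sqrtr// invr_ge0 mulr_ge0.
have a0 : 0 <= a by exact: sqrtr_ge0.
have aa0 : 0 < a ^+ 2 by rewrite aa invr_gt0 mulr_gt0.
have a1 : `|a| <= 2^-1.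
  rewrite ger0_norm// -(@ler_pXn2r _ 2) ?nnegrE ?invr_ge0// aa.
  rewrite (_ : (2^-1) ^+ 2 = 4^-1 :> R); last by field.
  by rewrite lef_pV2 ?posrE ?mulr_gt0//; lra.
have K1 : 8 * n%:R * a ^+ 2 = 1 by rewrite aa mulfV// gt_eqF// mulr_gt0.
have mSM (c : R) : measurable_fun setT (fun w => expR (c * (S w - M))).
  by apply: measurableT_comp => //; apply: measurable_funM => //; exact: measurable_funB.
have ie (c : R) : `|c| = a -> P.-integrable setT (EFin \o (fun w => expR (c * (S w - M)))) /\
    \int[P]_w expR (c * (S w - M)) <= 3.
  move=> ca; have cc : c ^+ 2 = a ^+ 2 by rewrite -real_normK ?num_real// ca.
  have := @S_exp c; rewrite ca -(ger0_norm a0) cc K1 => /(_ a1) h.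
  have ic : P.-integrable setT (EFin \o (fun w => expR (c * (S w - M)))).
    by apply: integrable_ge0 => //; apply: le_lt_trans h _; rewrite ltry.
  split => //; rewrite -lee_fin -EFin_Rintegral//.
  by rewrite (le_trans h)// lee_fin expR1_le3.
have [i1 e1] := ie a (ger0_norm a0).
have [|i2 e2] := ie (- a); first by rewrite normrN ger0_norm.
have bnd w : (S w - M) ^+ 2 <= (a ^+ 2)^-1 * (expR (a * (S w - M)) + expR (- a * (S w - M)) - 2).
  by rewrite ler_pdivlMl// -exprMn mulNr; exact: sqr_le_cosh.
have ib : P.-integrable setT (EFin \o (fun w =>
    (a ^+ 2)^-1 * (expR (a * (S w - M)) + expR (- a * (S w - M)) - 2))).
  apply: integrableZR; apply: integrableBR; last exact: integrable_cstT.
  exact: integrableDR.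
have iq : P.-integrable setT (EFin \o (fun w => (S w - M) ^+ 2)).
  apply: (integrable_bound _ ib); first by apply: measurable_funX; exact: measurable_funB.
  by move=> w; rewrite ger0_norm ?sqr_ge0.
split => //; apply: le_trans (le_Rintegral _ iq ib _) _ => //.
rewrite RintegralZl//; last first.
  by apply: integrableBR; [exact: integrableDR|exact: integrable_cstT].
rewrite RintegralB//; [|exact: integrableDR|exact: integrable_cstT].
rewrite RintegralD// Rintegral_cstT aa invrK.
have h : \int[P]_w expR (a * (S w - M)) + \int[P]_w expR (- a * (S w - M)) - 2 <= 4 by lra.
by apply: le_trans (ler_wpM2l _ h) _; [rewrite mulr_ge0|lra].
Qed.

(** The slope [1 / 2] is the largest allowed, and [exp (8 / 4) <= 9]. Functions with another
    Lipschitz constant are rescaled to this one. *)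
Let euclid_tail F (t : R) : (forall x y, `|F x - F y| <= 2^-1 * euclid_norm (x - y)) ->
  (P [set w | (t < F (Xv w) - \int[P]_w F (Xv w))%R] <= (9 * expR (- t))%:E)%E.
Proof.
move=> F2; have h : 0 <= (2^-1 : R) <= 2^-1 by rewrite lexx andbT invr_ge0.
have H := @expR_centered_le_euclid _ _ _ _ _ _ lapX F 2^-1 h F2.
apply: chernoff_bound; last first.
  apply: le_trans H _; rewrite lee_fin (_ : 8 * _ = 2%:R * 1); last by field.
  rewrite expRM_natl; have := expR1_le3 R; have := expR_gt0 (1 : R); nra.
apply: measurable_funB => //.
have : P.-integrable setT (EFin \o (fun w => F (Xv w))).
  apply: (integrable_lipschitz lapX (c := 2^-1)) => x y.
  by rewrite (le_trans (F2 x y))// ler_wpM2l ?invr_ge0// euclid_norm_le_l1.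
by case/integrableP => /measurable_EFinP.
Qed.

(** * Comparison of [F (x / S)] with [F (x / M)] *)

Section lipschitz_projection.
Variable F : 'rV[R]_n -> R.
Hypothesis F1 : forall x y, `|F x - F y| <= euclid_norm (x - y).

Let g w := F ((S w)^-1 *: Xv w).
Let h w := F (M^-1 *: Xv w).
Let Q w := N w ^+ 2 + 2 * (S w - M) ^+ 2.

Let N_le_S w : N w <= S w. Proof. exact: euclid_norm_le_l1. Qed.

Let N_ge0 w : 0 <= N w. Proof. exact: euclid_norm_ge0. Qed.

Let unit_proj w : euclid_norm ((S w)^-1 *: Xv w) <= 1.
Proof.
rewrite euclid_normZ ger0_norm ?invr_ge0//.
have [S0|S0] := eqVneq (S w) 0; first by rewrite S0 invr0 mul0r.
have {}S0 : 0 < S w by rewrite lt_neqAle eq_sym S0 S_ge0.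
by rewrite mulrC ler_pdivrMr// mul1r N_le_S.
Qed.

Lemma measurable_lipschitz_projection : measurable_fun setT g.
Proof.
have cF : coord_measurable F.
  apply: (lipschitz_coord_measurable (c := 1)) => x y.
  by rewrite mul1r (le_trans (F1 x y))// euclid_norm_le_l1.
(* The real power [-1] is measurable and agrees with inversion on nonnegative numbers, zero
   included. *)
have -> : g = (fun w => F (\row_i ((S w) `^ (-1) * X i w))).
  apply/funext => w; congr F; apply/rowP => i.
  by rewrite !mxE powR_inv1.
apply: cF => i; apply: measurable_funM; last by case: lapX => /(_ i)[].
exact: (measurableT_comp (@measurable_powR R (-1)) mS).
Qed.

Let dist_le2 w w' : `|g w - g w'| <= 2.
Proof.
apply: le_trans (F1 _ _) _; apply: le_trans (euclid_normD _ _) _.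
by rewrite euclid_normN; have := unit_proj w; have := unit_proj w'; lra.
Qed.

Lemma integrable_lipschitz_projection : P.-integrable setT (EFin \o g).
Proof.
apply: (integrable_bound (g := fun=> `|F 0| + 1)).
- exact: measurable_lipschitz_projection.
- exact: integrable_cstT.
move=> w; have := F1 ((S w)^-1 *: Xv w) 0; rewrite subr0 => H.
have := ler_normD (g w - F 0) (F 0); rewrite subrK.
have := unit_proj w; rewrite /g in H *; lra.
Qed.

Let ig := integrable_lipschitz_projection.
Let mg := measurable_lipschitz_projection.

Let ih : P.-integrable setT (EFin \o h).
Proof.
apply: (integrable_lipschitz lapX (F := fun x => F (M^-1 *: x)) (c := M^-1)) => x y.
apply: le_trans (F1 _ _) _; rewrite -scalerBr euclid_normZ ger0_norm ?invr_ge0 ?(ltW M_gt0)//.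
by rewrite ler_wpM2l ?invr_ge0 ?(ltW M_gt0)// euclid_norm_le_l1.
Qed.

Let mh : measurable_fun setT h.
Proof. by apply/measurable_EFinP; case/integrableP: ih. Qed.

(** With [D = |S - M|], the Lipschitz bound times [M ^ 2] is [D * M * N / S]. If [M <= 2 * S] this
    is at most [2 * D * N <= N ^ 2 + D ^ 2]. Otherwise [M <= 2 * D], and [N <= S] leaves
    [D * M <= 2 * D ^ 2]. If [S = 0], both [g] and [h] equal [F 0]. *)
Let gh_le w : `|g w - h w| <= M ^- 2 * Q w.
Proof.
rewrite ler_pdivlMl ?exprn_gt0//.
have Q0 : 0 <= Q w by rewrite addr_ge0 ?sqr_ge0// mulr_ge0 ?sqr_ge0.
have gh : `|g w - h w| <= `|(S w)^-1 - M^-1| * N w.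
  by apply: le_trans (F1 _ _) _; rewrite -scalerBl euclid_normZ.
have [S0|S0] := eqVneq (S w) 0.
  have N0 : N w = 0 by apply/eqP; rewrite eq_le N_ge0 -{1}S0 N_le_S.
  rewrite (_ : `|g w - h w| = 0) ?mulr0//.
  by apply/eqP; rewrite eq_le normr_ge0 andbT; move: gh; rewrite N0 mulr0.
have {}S0 : 0 < S w by rewrite lt_neqAle eq_sym S0 S_ge0.
have e : M ^+ 2 * (`|(S w)^-1 - M^-1| * N w) = `|S w - M| * M * (N w / S w).
  rewrite (_ : (S w)^-1 - M^-1 = (M - S w) / (S w * M)); last first.
    by field; rewrite !gt_eqF.
  rewrite normrM [`|(_ * _)^-1|]gtr0_norm ?invr_gt0 ?mulr_gt0// distrC.
  by field; rewrite !gt_eqF.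
apply: (@le_trans _ _ (M ^+ 2 * (`|(S w)^-1 - M^-1| * N w))).
  by rewrite ler_wpM2l ?sqr_ge0.
rewrite e /Q; set D := `|S w - M|.
have -> : (S w - M) ^+ 2 = D ^+ 2 by rewrite real_normK ?num_real.
have D0 : 0 <= D by exact: normr_ge0.
have DM : M - S w <= D by rewrite /D distrC ler_norm.
have [SM|SM] := leP M (2 * S w).
  apply: (@le_trans _ _ (D * (2 * N w))).
    rewrite -mulrA ler_wpM2l// mulrA ler_pdivrMr//.
    by have := ler_wpM2r (N_ge0 w) SM; lra.
  by have := sqr_ge0 (N w - D); have := sqr_ge0 D; nra.
apply: (@le_trans _ _ (D * M)).
  by rewrite ler_piMr ?mulr_ge0 ?(ltW M_gt0)// ler_pdivrMr// mul1r.
by have := sqr_ge0 (N w); nra.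
Qed.

Let mQ : measurable_fun setT Q.
Proof.
apply: measurable_funD; first exact: measurable_funX.
by apply: measurable_funM => //; apply: measurable_funX; exact: measurable_funB.
Qed.

Let iQ : P.-integrable setT (EFin \o Q) /\ \int[P]_w Q w <= 67 * n%:R.
Proof.
have [i1 e1] := iN2; have [i2 e2] := iSM.
split; first by apply: integrableDR => //; exact: integrableZR.
rewrite RintegralD//; last exact: integrableZR.
rewrite RintegralZl//; have := nR; lra.
Qed.

(** The mean of [Q] is at most [(8 / 3 + 2 * 32) * n <= 67 * n], and [M ^ 2 >= 81 / 100 * n ^ 2]. *)
Let bias_le : `|\int[P]_w h w - \int[P]_w g w| <= 90 / n%:R.
Proof.
have [i1 e1] := iQ.
rewrite distrC -RintegralB//.
have ib : P.-integrable setT (EFin \o (fun w => M ^- 2 * Q w)) by exact: integrableZR.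
have igh : P.-integrable setT (EFin \o (fun w => g w - h w)) by exact: integrableBR.
apply: le_trans (le_normr_Rintegral _ igh) _ => //.
apply: le_trans (le_Rintegral _ _ ib _) _ => //.
- apply: (integrable_bound _ ib).
    by apply: (measurableT_comp (@normr_measurable R setT)); exact: measurable_funB.
  by move=> w; rewrite normr_id.
rewrite RintegralZl// ler_pdivrMl ?exprn_gt0//.
apply: (le_trans e1); rewrite mulrA ler_pdivlMr//.
have : (9 / 10 * n%:R) ^+ 2 <= M ^+ 2.
  by rewrite ler_pXn2r ?nnegrE ?mulr_ge0 ?(ltW M_gt0)//.
by have := sqr_ge0 (n%:R : R); nra.
Qed.

Let dist_mean_le2 w : `|g w - \int[P]_w' g w'| <= 2.
Proof.
have up : \int[P]_w' g w' <= g w + 2.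
  rewrite -[leRHS](Rintegral_cstT P); apply: le_Rintegral => //; first exact: integrable_cstT.
  by move=> w' _; have := dist_le2 w w'; rewrite ler_norml; lra.
have lo : g w - 2 <= \int[P]_w' g w'.
  rewrite -[leLHS](Rintegral_cstT P); apply: le_Rintegral => //; first exact: integrable_cstT.
  by move=> w' _; have := dist_le2 w w'; rewrite ler_norml; lra.
by rewrite ler_norml; lra.
Qed.

Lemma lipschitz_projection_concentration (r : R) : 1600 <= r * n%:R ->
  (P [set w | (r < `|g w - \int[P]_w g w|)%R] <=
     (361 * expR (- (3 / 1000) * r * n%:R))%:E)%E.
Proof.
(* The values of [g] lie within 2 of its mean, so the event is empty for [r > 2]; the remaining
   range keeps [rho] below [3 / 2]. *)
move=> rn; have [r2|r2] := leP r 2; last first.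
  rewrite (_ : [set w | _] = set0) ?measure0 ?lee_fin ?mulr_ge0 ?expR_ge0//.
  by apply/seteqP; split => w //=; rewrite ltNge (le_trans (dist_mean_le2 w))// ltW.
have r0 : 0 < r by rewrite -(pmulr_lgt0 _ nR); lra.
set rho := Num.sqrt r.
have rho2 : rho ^+ 2 = r by rewrite sqr_sqrtr// ltW.
have rho0 : 0 < rho by rewrite sqrtr_gt0.
have rho15 : rho <= 3 / 2.
  rewrite -(@ler_pXn2r _ 2) ?nnegrE ?(ltW rho0) ?divr_ge0// rho2; lra.
set E := expR _.
have mabs (f : T -> R) : measurable_fun setT f -> measurable_fun setT (fun w => `|f w|).
  by move=> mf; exact: (measurableT_comp (@normr_measurable R setT)).
have mgh : measurable_fun setT (fun w => `|g w - h w|) by apply: mabs; exact: measurable_funB.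
have mSM : measurable_fun setT (fun w => `|S w - M|) by apply: mabs; exact: measurable_funB.
have mhh : measurable_fun setT (fun w => `|h w - \int[P]_w h w|) by apply: mabs; exact: measurable_funB.
(* The thresholds [2 / 5] here and [14 / 25] for [N] satisfy [(14 / 25) ^ 2 + 2 * (2 / 5) ^ 2 <= 4 /
   5 * 81 / 100], as [pgh] requires. *)
have pS : (P [set w | (2 / 5 * n%:R * rho < `|S w - M|)%R] <= (2 * E)%:E)%E.
  apply: (le_trans (S_tail _)).
    by rewrite !mulr_gt0//=; nra.
  rewrite lee_fin ler_pM2l// ler_expR.
  rewrite (_ : _ / (32 * n%:R) = r * n%:R / 200); last first.
    by rewrite -rho2; field; rewrite gt_eqF.
  lra.
have nr : r * n%:R <= 3 / 2 * (n%:R * rho).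
  by rewrite -rho2; have := ler_wpM2r (mulr_ge0 (ltW nR) (ltW rho0)) rho15; lra.
have pN : (P [set w | (14 / 25 * n%:R * rho < N w)%R] <= (9 * E)%:E)%E.
  (* From [N <= N ^ 2 / (2 * c) + c / 2]: the first term has mean at most [n * rho / 100] once
     [r * n >= 4000 / 3], which the threshold 1600 ensures. What remains of [14 / 25] is [1 / 2],
     halved again by the slope. *)
  have EN : \int[P]_w N w <= 3 / 50 * (n%:R * rho).
    pose c := n%:R * rho / 10; have c0 : 0 < c by rewrite divr_gt0// mulr_gt0.
    have [i2 e2] := iN2.
    have ib : P.-integrable setT (EFin \o (fun w => c^-1 / 2 * N w ^+ 2 + c / 2)).
      by apply: integrableDR; [exact: integrableZR|exact: integrable_cstT].
    apply: le_trans (le_Rintegral _ iN ib _) _ => //.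
      move=> w _; rewrite -subr_ge0 (_ : _ - _ = (N w - c) ^+ 2 / (2 * c)).
        by rewrite divr_ge0 ?sqr_ge0// mulr_ge0// ltW.
      by field; rewrite gt_eqF.
    rewrite RintegralD//; [|exact: integrableZR|exact: integrable_cstT].
    rewrite RintegralZl// Rintegral_cstT.
    have c2 : 0 <= c^-1 / 2 by rewrite divr_ge0// invr_ge0 ltW.
    apply: (@le_trans _ _ (c^-1 / 2 * (8 / 3 * n%:R) + c / 2)).
      by rewrite lerD2r ler_wpM2l.
    rewrite (_ : c^-1 / 2 * _ = 40 / (3 * rho)); last by rewrite /c; field; rewrite !gt_eqF.
    rewrite -lerBrDr ler_pdivrMr ?mulr_gt0//.
    rewrite (_ : _ * (3 * rho) = 3 / 100 * (r * n%:R)); last by rewrite /c -rho2; field.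
    lra.
  have := @euclid_tail (fun x => 2^-1 * euclid_norm x) (1 / 4 * (n%:R * rho)).
  rewrite RintegralZl// -/N => H.
  apply: le_trans (le_trans (H _) _).
  - apply: le_measure; rewrite ?inE.
    + exact: measurable_gt.
    + by apply: measurable_gt; apply: measurable_funB => //; exact: measurable_funM.
    + by move=> w /= Nw; rewrite -/(N w); lra.
  - by move=> x y; have := euclid_lip 2^-1 x y; rewrite [`|2^-1|]ger0_norm ?invr_ge0.
  by rewrite lee_fin ler_pM2l// ler_expR; lra.
have ph : (P [set w | (r / 10 < `|h w - \int[P]_w h w|)%R] <= (9 * E + 9 * E)%:E)%E.
  (* The function [M / 2] times [h] is Lipschitz with constant [1 / 2]; the sign [s] covers the two
     sides of the deviation. *)
  have tail (s : R) : `|s| = 1 ->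
      (P [set w | (M * r / 20 < s * 2^-1 * M * h w - s * 2^-1 * M * \int[P]_w h w)%R] <= (9 * E)%:E)%E.
    move=> s1; have := @euclid_tail (fun x => s * 2^-1 * M * F (M^-1 *: x)) (M * r / 20).
    rewrite RintegralZl// => H; apply: le_trans (H _) _.
      move=> x y; rewrite -mulrBr !normrM s1 mul1r [`|M|]gtr0_norm// [`|2^-1|]ger0_norm ?invr_ge0//.
      rewrite -mulrA ler_wpM2l ?invr_ge0// -ler_pdivlMl//; apply: le_trans (F1 _ _) _.
      by rewrite -scalerBr euclid_normZ gtr0_norm ?invr_gt0.
    rewrite lee_fin ler_pM2l// ler_expR.
    have := ler_wpM2r (ltW r0) M_ge; lra.
  apply: probability_sub_union (tail 1 _) (tail (- 1) _); rewrite ?normrN ?normr1//.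
  - exact: measurable_gt.
  - by apply: measurable_gt; apply: measurable_funB => //; exact: measurable_funM.
  - by apply: measurable_gt; apply: measurable_funB => //; exact: measurable_funM.
  move=> w /=; set D := h w - _ => rD.
  have rM : M * r / 20 < 2^-1 * M * `|D|.
    by have : M * (r / 10) < M * `|D|; [rewrite ltr_pM2l|lra].
  move: rM; rewrite /D; case: (lerP 0 (h w - \int[P]_w h w)) => [/ger0_norm ->|/ltr0_norm ->] ?; [left|right]; lra.
have pgh : (P [set w | (4 / 5 * r < `|g w - h w|)%R] <= (9 * E + 2 * E)%:E)%E.
  apply: probability_sub_union pN pS; [exact: measurable_gt|exact: measurable_gt|exact: measurable_gt|].
  move=> w /= rgh; apply/orP; rewrite -[X in X || _]negbK -implybE; apply/implyP.
  rewrite -leNgt => Nw; rewrite ltNge; apply/negP => SMw.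
  move: rgh; rewrite ltNge => /negP; apply; apply: (le_trans (gh_le w)).
  rewrite ler_pdivrMl ?exprn_gt0//.
  have M2 : (9 / 10 * n%:R) ^+ 2 <= M ^+ 2.
    by rewrite ler_pXn2r ?nnegrE ?mulr_ge0 ?(ltW M_gt0)//.
  have N2 : N w ^+ 2 <= (14 / 25 * n%:R * rho) ^+ 2.
    by rewrite ler_pXn2r ?nnegrE ?mulr_ge0// ltW.
  have D2 : (S w - M) ^+ 2 <= (2 / 5 * n%:R * rho) ^+ 2.
    by rewrite -real_normK ?num_real// ler_pXn2r ?nnegrE ?mulr_ge0// ltW.
  have sq (c : R) : (c * n%:R * rho) ^+ 2 = c ^+ 2 * (n%:R ^+ 2 * r) by rewrite -rho2; ring.
  move: N2 D2 (ler_wpM2l (ltW r0) M2); rewrite !sq /Q.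
  rewrite (_ : (9 / 10 * n%:R) ^+ 2 = 81 / 100 * n%:R ^+ 2); last by field.
  have : 0 <= n%:R ^+ 2 * r by rewrite mulr_ge0 ?sqr_ge0// ltW.
  move: (N w ^+ 2) ((S w - M) ^+ 2) (M ^+ 2) (n%:R ^+ 2) => a b c m.
  have -> : (14 / 25) ^+ 2 = 196 / 625 :> R by field.
  have -> : (2 / 5) ^+ 2 = 4 / 25 :> R by field.
  lra.
have E0 : 0 < E by exact: expR_gt0.
apply: (@le_trans _ _ ((9 * E + 9 * E) + (9 * E + 2 * E))%:E); last first.
  by rewrite lee_fin; nra.
apply: probability_sub_union ph pgh; [|exact: measurable_gt|exact: measurable_gt|].
  by apply: measurable_gt; apply: mabs; exact: measurable_funB.
move=> w /= rg; apply/orP; rewrite -[X in X || _]negbK -implybE; apply/implyP.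
rewrite -leNgt => hw; rewrite ltNge; apply/negP => ghw.
have b : 90 / n%:R <= r / 10 by rewrite ler_pdivrMr//; lra.
have := bias_le; move: rg hw ghw.
set eg := \int[P]_w g w; set eh := \int[P]_w h w.
rewrite ltNge => /negP + hw ghw bl; apply.
rewrite (_ : g w - eg = (g w - h w) + (h w - eh) + (eh - eg)); last by ring.
apply: (le_trans (ler_normD _ _)).
have := ler_normD (g w - h w) (h w - eh); lra.
Qed.

End lipschitz_projection.

End laplace_vector.

(** * From the extension back to [f] *)

(** Where [S = 0], [f] is evaluated at 0, off the sphere, and nothing is known of its value; that
    event lies in the null event that one chosen coordinate vanishes. *)
Lemma l1_norm_coords_eq0_null (dT : measure_display) (T : measurableType dT) (R : realType)
  (P : probability T R) (d : nat) (X : 'I_d -> T -> R) :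
  (0 < d)%N -> std_laplace_vector P X ->
  exists Z : set T, [/\ measurable Z, P Z = 0%E &
    [set w | \sum_(j < d) `|X j w| = 0] `<=` Z].
Proof.
move=> d0 [lapX _]; have [mX XE] := lapX (Ordinal d0).
exists (X (Ordinal d0) @^-1` [set 0]); split.
- by rewrite -[X in measurable X]setTI; exact: mX.
- by rewrite XE// integral_set1.
move=> w /= /eqP; rewrite psumr_eq0// => /allP /(_ (Ordinal d0) (mem_index_enum _)) /eqP.
by move=> /eqP; rewrite normr_eq0 => /eqP.
Qed.

Theorem theorem2 (R : realType) (dT : measure_display) (T : measurableType dT)
  (P : probability T R) (d : nat) (X : 'I_d -> T -> R)
  (f : 'rV[R]_d -> R) (r : R) :
  (0 < d)%N ->
  std_laplace_vector P X ->
  lipschitz1_on_l1_sphere f ->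
  0 < r ->
  let S := fun w => \sum_(j < d) `|X j w| in
  let Y := fun w => f ((S w)^-1 *: \row_(j < d) X j w) in
  (P [set w | (r%:E < `| (Y w)%:E - 'E_P[Y] |)%E ]
     <= (361 * expR (- (3 / 1000) * r * d%:R))%:E)%E.
Proof.
move=> d0 lapX fL r0; cbv zeta.
pose S w := \sum_(j < d) `|X j w|; pose Y w := f ((S w)^-1 *: \row_(j < d) X j w).
change (P [set w | r%:E < `|(Y w)%:E - 'E_P[Y]|] <= (361 * expR (- (3 / 1000) * r * d%:R))%:E)%E.
have mX i : measurable_fun setT (X i) by case: lapX => /(_ i)[].
have [Z [mZ PZ SZ]] := l1_norm_coords_eq0_null d0 lapX.
have [||F [F1 Ff]] := @mcshane_extension R d (l1_sphere R d) f.
- exists (\row_i (i == Ordinal d0)%:R); rewrite /l1_sphere /l1_norm/= (bigD1 (Ordinal d0))//=.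
  rewrite mxE eqxx normr1 big1 ?addr0// => i i0.
  by rewrite mxE (negbTE i0) normr0.
- by move=> u v Du Dv; apply: fL; rewrite inE.
pose g w := F ((l1_norm (\row_(j < d) X j w))^-1 *: \row_(j < d) X j w).
have l1E w : l1_norm (\row_(j < d) X j w) = S w.
  by apply: eq_bigr => i _; rewrite mxE.
have Yg w : S w != 0 -> Y w = g w.
  move=> S0; rewrite /Y /g l1E Ff// /l1_sphere/= /l1_norm.
  rewrite (eq_bigr (fun i => `|(S w)^-1| * `|X i w|)); last first.
    by move=> i _; rewrite !mxE normrM.
  by rewrite -mulr_sumr ger0_norm ?invr_ge0 ?sumr_ge0// mulVf.
have mg : measurable_fun setT g := measurable_lipschitz_projection lapX F1.
have ig : P.-integrable setT (EFin \o g) := integrable_lipschitz_projection lapX F1.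
have mS : measurable_fun setT S.
  by apply: measurable_sum => i; exact: (measurableT_comp (@normr_measurable R setT) (mX i)).
(* Measurability of [Y] cannot come from [f]: it comes from [g] where [S] is nonzero, and elsewhere
   [0^-1 = 0] makes [Y] equal to the constant [f 0]. *)
have YE : Y = (fun w => if S w == 0 then f 0 else g w).
  apply/funext => w; case: ifPn => [/eqP S0|/Yg//].
  by rewrite /Y S0 invr0 scale0r.
have mY : measurable_fun setT Y.
  rewrite YE; apply: measurable_fun_ifT => //.
  by apply: measurable_fun_eqr => //.
have EY : ('E_P[Y] = (\int[P]_w g w)%R%:E)%E.
  rewrite unlock -EFin_Rintegral//; apply: ae_eq_integral => //.
  - exact/measurable_EFinP.
  - exact/measurable_EFinP.
  exists Z; split => // w /= H; apply: SZ => /=; apply: contrapT => S0.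
  by apply: H => _; rewrite Yg//; exact/eqP.
rewrite EY.
rewrite [X in P X](_ : _ = [set w | r < `|Y w - \int[P]_w g w|]); last first.
  by apply/seteqP; split => w /=; rewrite lte_fin.
have mabs (h : T -> R) : measurable_fun setT h -> measurable_fun setT (fun w => `|h w|).
  by move=> mh; exact: (measurableT_comp (@normr_measurable R setT)).
have mev (h : T -> R) (c : R) : measurable_fun setT h -> measurable [set w | r < `|h w - c|].
  by move=> mh; apply: measurable_gt; apply: mabs; exact: measurable_funB.
(* Below 1600 the exponent exceeds [- 4.8], and [361 * exp (- 5) >= 1] because
   [e ^ 5 <= 3 ^ 5 = 243]. *)
have [rd|rd] := ltP (r * d%:R) 1600.
  apply: (@le_trans _ _ 1%E); first by apply: probability_le1; exact: mev.
  rewrite lee_fin.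
  have e5 : expR 5 <= 361 :> R.
    rewrite (_ : 5 = 5%:R * 1); last by rewrite mulr1.
    rewrite expRM_natl; apply: (@le_trans _ _ (3 ^+ 5)); last by lra.
    by rewrite ler_pXn2r ?nnegrE ?expR_ge0// expR1_le3.
  have : expR (- 5) <= expR (- (3 / 1000) * r * d%:R) by rewrite ler_expR; lra.
  have := expRxMexpNx_1 (5 : R); have := expR_gt0 (- 5 : R); nra.
rewrite -[_ * expR _]addr0.
apply: (@probability_sub_union _ _ _ P _ [set w | r < `|g w - \int[P]_w g w|] Z) => //.
- exact: mev.
- exact: mev.
- move=> w /=; have [S0 _|S0] := eqVneq (S w) 0; first by right; exact: SZ.
  by rewrite Yg//; left.
- exact: (lipschitz_projection_concentration lapX).
- by rewrite PZ.
Qed.
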